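(* Let $0<c<1$. Then an extremal pair exists for $F(c)$; that is, there exist $f,g\in S^1$ such that $$\sup_{c\le |z|<1}\left|\frac{f(z)}{g(z)}\right| = F(c).$$
   Context: $\mathbb{D}=\{z\in\mathbb{C}:|z|<1\}$. The Bergman space $\mathcal{A}^2(\mathbb{D})$ is the set of analytic functions $f$ on $\mathbb{D}$ with $\|f\|_2=\left(\frac1\pi\int_{\mathbb{D}}|f(z)|^2\,dA(z)\right)^{1/2}<\infty$, where $dA$ is Lebesgue area measure. $S^1=\{f\in\mathcal{A}^2(\mathbb{D}):\|f\|_2=1\}$. For $0<c<1$, $$F(c)=\inf_{f,g\in S^1}\ \sup_{c\le|z|<1}\left|\frac{f(z)}{g(z)}\right|,$$ where $f/g$ is understood as a meromorphic function on $\mathbb{D}$ (common zeros cancelled, value $\infty$ at poles). *)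

(* Defs.v *)
From HB Require Import structures.
From mathcomp Require Import all_boot all_order all_algebra.
From mathcomp Require Import complex.
From mathcomp Require Import all_classical all_reals all_analysis.

Set Implicit Arguments.
Unset Strict Implicit.
Unset Printing Implicit Defensive.

Import Order.TTheory GRing.Theory Num.Theory.
Import numFieldNormedType.Exports.

Local Open Scope classical_set_scope.
Local Open Scope complex_scope.
Local Open Scope ring_scope.

(* [`|z|] on [R[i]] takes values in [R[i]]; this is the modulus as an element
   of [R]. *)
Notation modulus z := (ComplexField.Normc.normc z).

Section Bergman.
Context {R : realType}.

Definition unit_disc : set R[i] := [set z | modulus z < 1].

(* Functions on the disc are represented by total functions on [R[i]]; no
   definition below depends on their values outside the disc.
   [R[i]^o] is [R[i]] with the topology given by its norm. *)
Definition analytic_on (U : set R[i]) (f : R[i] -> R[i]) : Prop :=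
  forall z0, U z0 -> exists (r : R) (a : nat -> R[i]),
    0 < r /\
    forall z : R[i], modulus (z - z0) < r ->
      ([series a k * (z - z0) ^+ k]_k : nat -> R[i]^o) @ \oo
        --> (f z : R[i]^o).

Definition bergman_norm (f : R[i] -> R[i]) : \bar R :=
  (((pi^-1)%:E *
    \int[(@lebesgue_measure R) \x (@lebesgue_measure R)]_(p in
        [set p : R * R | unit_disc (p.1 +i* p.2)])
      (modulus (f (p.1 +i* p.2)) ^+ 2)%:E) `^ (2^-1))%E.

Definition bergman_space : set (R[i] -> R[i]) :=
  [set f | analytic_on unit_disc f /\ (bergman_norm f < +oo)%E].

Definition bergman_sphere : set (R[i] -> R[i]) :=
  [set f | bergman_space f /\ bergman_norm f = 1%E].

(* [quotient_modulus f g z v]: the meromorphic function f / g has modulus v at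
   z.  The common zero of f and g at z is cancelled by writing
   f = (w - z)^m f1 and g = (w - z)^m g1 on the disc, with f1 and g1 analytic
   and not both zero at z.  If f and g are analytic on the disc and not both
   identically zero there, there is exactly one such v for each z in the
   disc. *)
Definition quotient_modulus (f g : R[i] -> R[i]) (z : R[i]) (v : \bar R) :
    Prop :=
  exists (m : nat) (f1 g1 : R[i] -> R[i]),
    [/\ analytic_on unit_disc f1 /\ analytic_on unit_disc g1,
        forall w, unit_disc w ->
          f w = (w - z) ^+ m * f1 w /\ g w = (w - z) ^+ m * g1 w,
        f1 z != 0 \/ g1 z != 0 &
        v = if g1 z == 0 then +oo%E else (modulus (f1 z / g1 z))%:E].

Definition quotient_sup (c : R) (f g : R[i] -> R[i]) : \bar R :=
  ereal_sup [set v | exists z : R[i],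
    c <= modulus z < 1 /\ quotient_modulus f g z v].

Definition extremal_value (c : R) : \bar R :=
  ereal_inf [set s | exists f g : R[i] -> R[i],
    [/\ bergman_sphere f, bergman_sphere g & s = quotient_sup c f g]].

End Bergman.

(* Main.v *)
Require Import Defs.
From HB Require Import structures.
From mathcomp Require Import all_boot all_order all_algebra.
From mathcomp Require Import complex.
From mathcomp Require Import all_classical all_reals all_analysis.
From mathcomp Require Import measurable_realfun.
From mathcomp Require Import separable cyclic cyclotomic.
From mathcomp Require Import ring lra zify.

(** Write [F] for the infimum.  If [F >= 1], a normalized constant paired with
    itself is extremal, since its quotient is identically [1].  So let [F < 1] and
    take pairs [fn, gn] in the unit sphere with [|fn| <= tn |gn|] on the ring
    [c <= |z| < 1], where [tn] decreases to [F] and stays below some [s < 1].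

    The sphere is a normal family: the mean square over the disc bounds the
    [k]-th Taylor coefficient by a constant multiple of [r ^- k], for every radius
    [r < 1] ([energy_coef_bound]), so along suitable indices all coefficients converge,
    and with them the functions, pointwise on the disc ([bergman_sphere_compact]).
    The limits satisfy [|f| <= F |g|] on the ring.  Their norms may have dropped,
    because mass can escape to the boundary, but [g] loses at least as much as
    [f]: on the ring [|gn|^2 - |fn|^2 >= 0], so Fatou's lemma applies to this
    difference, while on [|z| < c] the integrals converge.  As [fn] and [gn] have
    the same norm, this gives [norm g <= norm f] ([energy_limit]).  Dividing each
    limit by its norm can therefore only decrease the quotient, and the normalized
    pair realizes [F].  The limits are not zero: at least the fraction [1 - s^2] of
    the squared norm of [fn] lies in [|z| < c], whence [f <> 0], and if [g] were
    zero then [f] would vanish on the ring, hence everywhere.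

    Common zeros cause no trouble in either direction.  From the quotient to the
    inequality [|f| <= t |g|], a point where both vanish satisfies the inequality,
    and elsewhere no cancellation takes place ([quotient_sup_pointwise]).  From the
    inequality to the quotient, continuity carries it to the cancelled functions
    ([quotient_sup_le]).

    The complex analysis is that of power series, with roots of unity in place of
    contour integrals.  Averaging a polynomial over the vertices of a regular
    polygon isolates a coefficient.  On one circle this is Cauchy's estimate
    ([Cauchy_estimate]), and with it the uniqueness of expansions.  Integrated over
    a disc, whose area measure is rotation invariant ([integral_rotation]), it is
    the mean square bound.  An analytic function is given locally by power series;
    that the expansion at [0] represents it on the whole disc
    ([analytic_expansion]) follows from Cauchy's estimate for all derivatives,
    which pushes the radius of convergence past any circle inside the disc. *)

Set Implicit Arguments.
Unset Strict Implicit.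
Unset Printing Implicit Defensive.

Import Order.TTheory GRing.Theory Num.Theory.
Import numFieldNormedType.Exports.

Local Open Scope classical_set_scope.
Local Open Scope complex_scope.
Local Open Scope ring_scope.

(** * The modulus on the complex numbers *)

Section Modulus.
Context {R : realType}.
Implicit Types (z w : R[i]) (x y e : R).

Lemma modulus_ge0 z : 0 <= modulus z.
Proof. by case: z => a b; rewrite sqrtr_ge0. Qed.

Lemma modulus0 : modulus (0 : R[i]) = 0.
Proof. exact: ComplexField.Normc.normc0. Qed.

Lemma modulus1 : modulus (1 : R[i]) = 1.
Proof. exact: ComplexField.Normc.normc1. Qed.

Lemma modulusM z w : modulus (z * w) = modulus z * modulus w.
Proof. exact: ComplexField.Normc.normcM. Qed.

Lemma modulusX z n : modulus (z ^+ n) = modulus z ^+ n.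
Proof.
by elim: n => [|n IH]; rewrite ?expr0 ?modulus1// !exprS modulusM IH.
Qed.

Lemma modulusN z : modulus (- z) = modulus z.
Proof. exact: normcN. Qed.

Lemma modulusV z : modulus z^-1 = (modulus z)^-1.
Proof. exact: ComplexField.Normc.normcV. Qed.

Lemma modulus_eq0 z : (modulus z == 0) = (z == 0).
Proof.
apply/eqP/eqP => [|->]; last exact: modulus0.
exact: ComplexField.Normc.eq0_normc.
Qed.

Lemma modulus_real x : modulus (x%:C) = `|x|.
Proof. by rewrite /ComplexField.Normc.normc /= expr0n /= addr0 sqrtr_sqr. Qed.

Lemma modulus_sqr z : modulus z ^+ 2 = complex.Re z ^+ 2 + complex.Im z ^+ 2.
Proof. by case: z => a b /=; rewrite sqr_sqrtr// addr_ge0 ?sqr_ge0. Qed.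

Lemma modulusD z w : modulus (z + w) <= modulus z + modulus w.
Proof. exact: le_normcD. Qed.

Lemma modulusC z w : modulus (z - w) = modulus (w - z).
Proof. by rewrite -modulusN opprB. Qed.

Lemma modulus_triangle u z w :
  modulus (z - w) <= modulus (z - u) + modulus (u - w).
Proof.
by rewrite [X in modulus X <= _](_ : _ = (z - u) + (u - w)) ?modulusD//; ring.
Qed.

Lemma modulus_distl z w : modulus z <= modulus w + modulus (z - w).
Proof.
by rewrite [X in modulus X <= _](_ : _ = w + (z - w)) ?modulusD//; ring.
Qed.

Lemma modulus_sum (I : Type) (r : seq I) (P : pred I) (F : I -> R[i]) :
  modulus (\sum_(i <- r | P i) F i) <= \sum_(i <- r | P i) modulus (F i).
Proof.
elim/big_ind2 : _ => [|x1 x2 y1 y2 h1 h2|//]; first by rewrite modulus0.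
exact: le_trans (modulusD _ _) (lerD h1 h2).
Qed.

Lemma norm_Re_le z : `|complex.Re z| <= modulus z.
Proof.
rewrite -(ler_pXn2r (n := 2)) ?nnegrE ?modulus_ge0 ?normr_ge0//.
by rewrite modulus_sqr real_normK ?num_real// lerDl sqr_ge0.
Qed.

Lemma norm_Im_le z : `|complex.Im z| <= modulus z.
Proof.
rewrite -(ler_pXn2r (n := 2)) ?nnegrE ?modulus_ge0 ?normr_ge0//.
by rewrite modulus_sqr real_normK ?num_real// lerDr sqr_ge0.
Qed.

Lemma modulus_le_ReIm z :
  modulus z <= `|complex.Re z| + `|complex.Im z|.
Proof.
rewrite -(ler_pXn2r (n := 2)) ?nnegrE ?addr_ge0 ?modulus_ge0 ?normr_ge0//.
rewrite modulus_sqr sqrrD !real_normK ?num_real// addrAC lerDl.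
by rewrite mulrn_wge0// mulr_ge0.
Qed.

Lemma normC_modulus z : `|z| = (modulus z)%:C.
Proof. by case: z. Qed.

End Modulus.

(** * Limits of complex sequences *)

Section ComplexLimits.
Context {R : realType}.
Implicit Types (u v : nat -> R[i]) (l : R[i]).

(** Convergence in [R[i]^o], read off the real sequence of distances so that
    squeezing and the order of the reals are available. *)
Definition tends u l : Prop := modulus (u n - l) @[n --> \oo] --> (0 : R).

Lemma tendsP u l :
  (u : nat -> R[i]^o) @ \oo --> (l : R[i]^o) <-> tends u l.
Proof.
rewrite /tends; split=> [/cvgrPdist_lt ul|/cvgrPdist_lt ul].
  apply/cvgrPdist_lt => e e0.
  have /ul : (0 : R[i]) < e%:C by rewrite ltcR.
  apply: filterS => n; rewrite normC_modulus ltcR modulusC.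
  by rewrite sub0r normrN ger0_norm ?modulus_ge0.
apply/cvgrPdist_lt => e e0.
have [e1 e1E] : exists e1 : R, e = e1%:C.
  case: e e0 => a b; rewrite ltcE /= => /andP[/eqP -> _]; by exists a.
have {}e0 : 0 < e1 by rewrite -ltcR -e1E.
apply: filterS (ul _ e0) => n.
rewrite normC_modulus modulusC e1E ltcR.
by rewrite sub0r normrN ger0_norm ?modulus_ge0.
Qed.

Lemma tends_squeeze u l (b : nat -> R) :
  (\forall n \near \oo, modulus (u n - l) <= b n) ->
  b n @[n --> \oo] --> (0 : R) -> tends u l.
Proof.
move=> ub b0; apply: (squeeze_cvgr _ (cvg_cst 0) b0).
by apply: filterS ub => n ->; rewrite modulus_ge0.
Qed.

Lemma tends_near u l e : tends u l -> 0 < e ->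
  \forall n \near \oo, modulus (u n - l) < e.
Proof.
move=> /cvgr0Pnorm_lt ul e0; move: (ul _ e0).
by apply: filterS => n; rewrite ger0_norm ?modulus_ge0.
Qed.

Lemma tends_unique u l l' : tends u l -> tends u l' -> l = l'.
Proof.
move=> ul ul'; apply/eqP; rewrite -subr_eq0 -modulus_eq0.
rewrite eq_le modulus_ge0 andbT; apply/ler_addgt0Pr => e e0.
have [n /= [h1 h2]] := filter_ex (filterI
  (tends_near ul (divr_gt0 e0 (ltr0n R 2)))
  (tends_near ul' (divr_gt0 e0 (ltr0n R 2)))).
have := modulus_triangle (u n) l l'; rewrite (modulusC l (u n)).
lra.
Qed.

Lemma tends_modulus u l : tends u l ->
  modulus (u n) @[n --> \oo] --> (modulus l : R).
Proof.
move=> ul; apply/cvgrPdist_le => e e0.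
apply: filterS (tends_near ul e0) => n h.
have h1 := modulus_distl (u n) l; have := modulus_distl l (u n).
rewrite modulusC ler_norml; lra.
Qed.

Lemma tends_modulus_le u l M : tends u l ->
  (\forall n \near \oo, modulus (u n) <= M) -> modulus l <= M.
Proof.
move=> /tends_modulus ul uM; rewrite -(cvg_lim (@Rhausdorff R) ul).
by apply: limr_le => //; apply: cvgP ul.
Qed.

Lemma tendsD u v l l' : tends u l -> tends v l' ->
  tends (fun n => u n + v n) (l + l').
Proof.
move=> ul vl; apply: (@tends_squeeze _ _
    (fun n => modulus (u n - l) + modulus (v n - l'))).
  apply: nearW => n; apply: le_trans (modulusD _ _).
  by rewrite [X in modulus X <= _](_ : _ = (u n - l) + (v n - l'))//; ring.
by rewrite -[0]addr0; apply: cvgD.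
Qed.

Lemma tendsZ a u l : tends u l -> tends (fun n => a * u n) (a * l).
Proof.
move=> ul; apply: (@tends_squeeze _ _ (fun n => modulus a * modulus (u n - l))).
  by apply: nearW => n; rewrite -mulrBr modulusM.
by rewrite -[0](mulr0 (modulus a)); apply: cvgMr.
Qed.

Lemma tendsB u v l l' : tends u l -> tends v l' ->
  tends (fun n => u n - v n) (l - l').
Proof.
move=> ul /(tendsZ (-1)) vl; have := tendsD ul vl.
by rewrite mulN1r; congr tends; apply/funext => n; rewrite mulN1r.
Qed.

Lemma tends_cst l : tends (fun=> l) l.
Proof.
rewrite /tends; under eq_fun do rewrite subrr modulus0.
exact: cvg_cst.
Qed.

Lemma near_eq_tends u v l : (\forall n \near \oo, u n = v n) ->
  tends u l -> tends v l.
Proof.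
move=> uv ul; apply: tends_squeeze ul.
by apply: filterS uv => n ->.
Qed.

Lemma tends_ReIm u x y :
  complex.Re (u n) @[n --> \oo] --> (x : R) ->
  complex.Im (u n) @[n --> \oo] --> (y : R) -> tends u (x +i* y).
Proof.
move=> ux uy; apply: (@tends_squeeze _ _
  (fun n => `|complex.Re (u n) - x| + `|complex.Im (u n) - y|)).
  apply: nearW => n; apply: le_trans (modulus_le_ReIm _) _.
  by case: (u n).
rewrite -[0](addr0 0); apply: cvgD.
  by apply/norm_cvg0P/subr_cvg0.
by apply/norm_cvg0P/subr_cvg0.
Qed.

End ComplexLimits.

Local Arguments ComplexField.Normc.normc : simpl never.

(** * Power series with geometric bounds *)

Section PowerSeries.
Context {R : realType}.
Implicit Types (a b : nat -> R[i]) (z w l : R[i]) (s M : R).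

Definition psum a n z : R[i] := \sum_(k < n) a k * z ^+ k.

Definition has_psum a z l : Prop := tends (fun n => psum a n z) l.

(** A quantitative stand-in for the radius of convergence: some [M] works for
    every [s] below that radius, and conversely the bound gives geometric tails
    with explicit constants at every modulus below [s]. *)
Definition Cauchy_bound a s M : Prop := forall k, modulus (a k) * s ^+ k <= M.

Lemma has_psum_seriesP a z0 w l :
  ([series a k * (w - z0) ^+ k]_k : nat -> R[i]^o) @ \oo --> (l : R[i]^o) <->
  has_psum a (w - z0) l.
Proof.
rewrite tendsP /has_psum (_ : [series _]_k = fun n => psum a n (w - z0))//.
by apply/funext => n; rewrite /psum /series /= big_mkord.
Qed.

Lemma Cauchy_bound_ge0 a s M : Cauchy_bound a s M -> 0 <= M.
Proof.
by move=> /(_ 0%N); rewrite expr0 mulr1; apply: le_trans (modulus_ge0 _).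
Qed.

Lemma Cauchy_boundW a s s' M : 0 <= s' -> s' <= s ->
  Cauchy_bound a s M -> Cauchy_bound a s' M.
Proof.
move=> s0 ss aM k; apply: le_trans (aM k).
rewrite ler_wpM2l ?modulus_ge0// lerXn2r ?nnegrE//.
exact: le_trans ss.
Qed.

Lemma psumS a n z : psum a n.+1 z = psum a n z + a n * z ^+ n.
Proof. by rewrite /psum big_ord_recr. Qed.

Lemma psum_bound a s M n m z : 0 < s -> modulus z < s -> Cauchy_bound a s M ->
  (n <= m)%N ->
  modulus (psum a m z - psum a n z) <=
  M * (modulus z / s) ^+ n / (1 - modulus z / s).
Proof.
move=> s0 zs aM nm; set q := modulus z / s.
have q0 : 0 <= q by rewrite divr_ge0 ?modulus_ge0 ?ltW.
have q1 : q < 1 by rewrite ltr_pdivrMr ?mul1r.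
have M0 := Cauchy_bound_ge0 aM.
suff H : modulus (psum a m z - psum a n z) <=
    M * (q ^+ n - q ^+ m) / (1 - q).
  apply: le_trans H _; rewrite ler_pM2r ?invr_gt0 ?subr_gt0//.
  by apply: ler_wpM2l => //; rewrite lerBlDr lerDl exprn_ge0.
elim: m nm => [|m IH].
  by rewrite leqn0 => /eqP ->; rewrite !subrr modulus0 mulr0 mul0r.
rewrite leq_eqVlt => /predU1P[->|].
  by rewrite !subrr modulus0 mulr0 mul0r.
rewrite ltnS => /IH {}IH; rewrite psumS.
rewrite [X in modulus X](_ : _ = (psum a m z - psum a n z) + a m * z ^+ m);
  last by ring.
apply: le_trans (modulusD _ _) _.
have -> : M * (q ^+ n - q ^+ m.+1) / (1 - q) =
    M * (q ^+ n - q ^+ m) / (1 - q) + M * q ^+ m.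
  by rewrite exprS; field; rewrite subr_eq0 eq_sym lt_eqF.
apply: lerD => //; rewrite modulusM modulusX.
have -> : modulus z = q * s by rewrite /q divfK ?gt_eqF.
by rewrite exprMn mulrCA mulrC ler_wpM2r ?exprn_ge0.
Qed.

Lemma has_psum_tail a s M z l n : 0 < s -> modulus z < s ->
  Cauchy_bound a s M -> has_psum a z l ->
  modulus (l - psum a n z) <= M * (modulus z / s) ^+ n / (1 - modulus z / s).
Proof.
move=> s0 zs aM al; apply: (@tends_modulus_le _ (fun m => psum a m z - psum a n z)).
  by apply: tendsB al _; exact: tends_cst.
by exists n => // m /= nm; exact: psum_bound.
Qed.

Lemma tail_cvg0 M (q : R) : 0 <= q -> q < 1 ->
  M * q ^+ n / (1 - q) @[n --> \oo] --> (0 : R).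
Proof.
move=> q0 q1; rewrite -(mul0r (1 - q)^-1); apply: cvgMl.
rewrite -(mulr0 M); apply: cvgMr; apply: cvg_expr.
by rewrite ger0_norm.
Qed.

Lemma Re_sum (I : Type) (r : seq I) (P : pred I) (F : I -> R[i]) :
  complex.Re (\sum_(i <- r | P i) F i) = \sum_(i <- r | P i) complex.Re (F i).
Proof. by apply: big_morph => // -[? ?] [? ?]. Qed.

Lemma Im_sum (I : Type) (r : seq I) (P : pred I) (F : I -> R[i]) :
  complex.Im (\sum_(i <- r | P i) F i) = \sum_(i <- r | P i) complex.Im (F i).
Proof. by apply: big_morph => // -[? ?] [? ?]. Qed.

Lemma geometric_dominated_cvg (u : nat -> R) M (q : R) : 0 <= q -> q < 1 ->
  (forall k, `|u k| <= M * q ^+ k) ->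
  exists x : R, (\sum_(k < n) u k) @[n --> \oo] --> x.
Proof.
move=> q0 q1 uM.
have : cvgn (series u).
  apply: normed_cvg.
  apply: (@series_le_cvg _ (fun k => `|u k|) (geometric M q) _ _ uM).
  - by move=> k; exact: normr_ge0.
  - by move=> k; exact: le_trans (uM k).
  - by apply: is_cvg_geometric_series; rewrite ger0_norm.
move=> /cvg_ex[/= x ux]; exists x; apply: cvg_trans ux.
by apply: near_eq_cvg; apply: nearW => n; rewrite /series /= big_mkord.
Qed.

Lemma has_psum_exists a s M z : 0 < s -> modulus z < s -> Cauchy_bound a s M ->
  exists l, has_psum a z l.
Proof.
move=> s0 zs aM.
have q0 : 0 <= modulus z / s by rewrite divr_ge0 ?modulus_ge0 ?ltW.
have q1 : modulus z / s < 1 by rewrite ltr_pdivrMr ?mul1r.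
have aq k : modulus (a k * z ^+ k) <= M * (modulus z / s) ^+ k.
  rewrite modulusM modulusX -[X in _ * X ^+ _](@divfK _ s) ?gt_eqF//.
  by rewrite exprMn mulrCA mulrC ler_wpM2r ?exprn_ge0.
have [x rx] := geometric_dominated_cvg q0 q1
  (fun k => le_trans (norm_Re_le _) (aq k)).
have [y iy] := geometric_dominated_cvg q0 q1
  (fun k => le_trans (norm_Im_le _) (aq k)).
exists (x +i* y); apply: tends_ReIm.
  by under eq_fun do rewrite Re_sum.
by under eq_fun do rewrite Im_sum.
Qed.

Lemma has_psum_bounded a z l : has_psum a z l ->
  exists M, Cauchy_bound a (modulus z) M.
Proof.
move=> al; have [N _ aN] := tends_near al ltr01.
exists (2 + \sum_(k < N) modulus (a k) * modulus z ^+ k) => k.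
have h0 n : 0 <= modulus (a n) * modulus z ^+ n.
  by rewrite mulr_ge0 ?exprn_ge0 ?modulus_ge0.
have [kN|Nk] := ltnP k N.
  rewrite (bigD1 (Ordinal kN)) //= addrCA lerDl addr_ge0//.
  exact: sumr_ge0.
apply: (@le_trans _ _ 2); last by rewrite lerDl sumr_ge0.
rewrite -modulusX -modulusM.
have -> : a k * z ^+ k = (psum a k.+1 z - l) + (l - psum a k z).
  by rewrite psumS; ring.
apply: le_trans (modulusD _ _) _; rewrite (modulusC l).
have := aN k Nk; have := aN k.+1 (leqW Nk); rewrite /=; lra.
Qed.

Lemma has_psumB a b z l l' : has_psum a z l -> has_psum b z l' ->
  has_psum (fun k => a k - b k) z (l - l').
Proof.
move=> al bl; have := tendsB al bl; congr tends; apply/funext => n.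
by rewrite /psum -sumrB; apply: eq_bigr => k _; rewrite mulrBl.
Qed.

Lemma has_psumZ c a z l : has_psum a z l ->
  has_psum (fun k => c * a k) z (c * l).
Proof.
move=> /(tendsZ c); congr tends; apply/funext => n.
by rewrite /psum mulr_sumr; apply: eq_bigr => k _; rewrite mulrA.
Qed.

Lemma has_psum0 a : has_psum a 0 (a 0%N).
Proof.
apply: (near_eq_tends _ (tends_cst (a 0%N))).
exists 1%N => // -[//|n] _; rewrite /psum big_ord_recl expr0 mulr1 big1 ?addr0//.
by move=> k _; rewrite /= exprS mul0r mulr0.
Qed.

(** A power series is Lipschitz at its centre, by the tail estimate after the
    constant term. *)
Lemma has_psum_lipschitz a s M z l : 0 < s -> modulus z <= s / 2 ->
  Cauchy_bound a s M -> has_psum a z l ->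
  modulus (l - a 0%N) <= 2 * M / s * modulus z.
Proof.
move=> s0 zs aM al.
have zs' : modulus z < s by apply: le_lt_trans zs _; rewrite ltr_pdivrMr//; lra.
have := has_psum_tail 1 s0 zs' aM al.
rewrite psumS /psum big_ord0 add0r expr0 mulr1 expr1 => /le_trans; apply.
have M0 := Cauchy_bound_ge0 aM.
have q0 : 0 <= modulus z / s by rewrite divr_ge0 ?modulus_ge0 ?ltW.
have q1 : modulus z / s <= 2^-1 by rewrite ler_pdivrMr// mulrC.
rewrite ler_pdivrMr; last by lra.
rewrite (_ : 2 * M / s * modulus z = M * (modulus z / s) * 2); last by ring.
move: (modulus z / s) q0 q1 => q q0 q1.
have : 0 <= M * q * (1 - 2 * q) by rewrite !mulr_ge0//; lra.
by move: (M * q) => t; nra.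
Qed.

End PowerSeries.

(** * Averages over roots of unity and Cauchy's estimate *)

Section RootsOfUnity.
Context {R : realType}.
Implicit Types (a b : nat -> R[i]) (z w : R[i]).

Lemma primitive_root_exists N : (0 < N)%N ->
  exists w : R[i], N.-primitive_root w.
Proof.
move=> N0; pose p : {poly R[i]} := 'X^N - 1.
have [r] := closed_field_poly_normal p.
rewrite (monicP _) ?monicXnsubC // scale1r => pE.
have rN : all N.-unity_root r by apply/allP => x; rewrite -root_prod_XsubC -pE.
have sz : (N < (size r).+1)%N.
  by rewrite -(size_prod_XsubC r id) -pE size_XnsubC.
have [|w] := hasP (has_prim_root N0 rN _ sz); last by exists w.
rewrite -separable_prod_XsubC -pE separable_Xn_sub_1 //.
by rewrite pnatr_eq0 -lt0n.
Qed.

Lemma modulus_root w N : (0 < N)%N -> w ^+ N = 1 -> modulus w = 1.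
Proof.
move=> N0 /(congr1 (fun z => modulus z)); rewrite modulusX modulus1 => /eqP.
by rewrite (pexpr_eq1 N0 (modulus_ge0 w)) => /eqP.
Qed.

Lemma sum_root_powers w N m : N.-primitive_root w ->
  \sum_(j < N) w ^+ (j * m) = if (N %| m)%N then N%:R else 0.
Proof.
move=> wN; under eq_bigr do rewrite mulnC exprM.
case: ifPn => Nm.
  have -> : w ^+ m = 1 by apply/eqP; rewrite -(prim_order_dvd wN).
  by under eq_bigr do rewrite expr1n; rewrite sumr_const card_ord.
apply/eqP; have := subrX1 (w ^+ m) N.
rewrite -exprM mulnC exprM (prim_expr_order wN) expr1n subrr => /eqP.
rewrite eq_sym mulf_eq0 subr_eq0 => /orP[|//].
by rewrite -(prim_order_dvd wN) (negbTE Nm).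
Qed.

(** A discrete Fourier transform over the [N]-th roots of unity isolates one
    coefficient exactly, the factor [w ^+ (j * (N - k))] being the inverse of
    [w ^+ (j * k)]. *)
Lemma psum_root_average a w N L k z : N.-primitive_root w ->
  (L <= N)%N -> (k < L)%N ->
  \sum_(j < N) w ^+ (j * (N - k)) * psum a L (z * w ^+ j) =
  N%:R * (a k * z ^+ k).
Proof.
move=> wN LN kL.
have -> : \sum_(j < N) w ^+ (j * (N - k)) * psum a L (z * w ^+ j) =
    \sum_(l < L) a l * z ^+ l * \sum_(j < N) w ^+ (j * (N - k + l)).
  under eq_bigr do rewrite /psum mulr_sumr.
  rewrite exchange_big; apply: eq_bigr => l _ /=; rewrite mulr_sumr.
  apply: eq_bigr => j _; rewrite exprMn mulnDr exprD -exprM; ring.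
rewrite (bigD1 (Ordinal kL)) //= [X in _ + X]big1 ?addr0.
  rewrite sum_root_powers// subnK; last exact: ltnW (leq_trans kL LN).
  by rewrite dvdnn mulrC.
move=> l lk; rewrite sum_root_powers//; case: ifPn => [|_]; last by rewrite mulr0.
have kN := leq_trans kL LN.
have lN := leq_trans (ltn_ord l) LN.
have : l != k :> nat by [].
move=> lk' /dvdnP[[|[|q]]]; rewrite ?mul0n ?mul1n.
- by move/eqP; rewrite addn_eq0 subn_eq0 leqNgt kN.
- by move=> E; case/eqP: lk'; move: E kN lN; lia.
- by move: kN lN; nia.
Qed.

Lemma modulus_coef_average a w N L k z : N.-primitive_root w ->
  (L <= N)%N -> (k < L)%N ->
  N%:R * (modulus (a k) * modulus z ^+ k) <=
  \sum_(j < N) modulus (psum a L (z * w ^+ j)).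
Proof.
move=> wN LN kL; have N0 := prim_order_gt0 wN.
have w1 := modulus_root N0 (prim_expr_order wN).
have -> : N%:R * (modulus (a k) * modulus z ^+ k) =
    modulus (N%:R * (a k * z ^+ k)).
  rewrite !modulusM modulusX; congr (_ * _).
  by rewrite -[in RHS](rmorph_nat (real_complex R)) modulus_real normr_nat.
rewrite -(psum_root_average a z wN LN kL).
apply: le_trans (modulus_sum _ _ _) _; apply: ler_sum => j _.
by rewrite modulusM modulusX w1 expr1n mul1r.
Qed.

(** On a partial sum this is the triangle inequality in the average over the roots
    of unity; the tails are geometric and vanish in the limit. *)
Lemma Cauchy_estimate a (r s B M : R) : 0 < s -> s < r -> Cauchy_bound a r B ->
  (forall z l, modulus z = s -> has_psum a z l -> modulus l <= M) ->
  Cauchy_bound a s M.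
Proof.
move=> s0 sr aB aM k.
have r0 := lt_trans s0 sr.
have q0 : 0 <= s / r by rewrite divr_ge0 ?ltW.
have q1 : s / r < 1 by rewrite ltr_pdivrMr ?mul1r.
have bnd L : (k < L)%N ->
    modulus (a k) * s ^+ k <= M + B * (s / r) ^+ L / (1 - s / r).
  move=> kL; have L0 : (0 < L)%N by apply: leq_ltn_trans kL.
  have [w wL] := primitive_root_exists L0.
  have w1 := modulus_root L0 (prim_expr_order wL).
  have sE : modulus (s%:C : R[i]) = s by rewrite modulus_real gtr0_norm.
  have := modulus_coef_average a s%:C wL (leqnn L) kL; rewrite sE => H.
  rewrite -(ler_pM2l (x := L%:R)) ?ltr0n//; apply: le_trans H _.
  rewrite -[L%:R]/(L%:R) mulr_natl -[X in _ *+ X](card_ord L) -sumr_const.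
  apply: ler_sum => j _.
  have zE : modulus (s%:C * w ^+ j) = s.
    by rewrite modulusM modulusX w1 expr1n mulr1.
  have zr : modulus (s%:C * w ^+ j) < r by rewrite zE.
  have [l al] := has_psum_exists r0 zr aB.
  have := has_psum_tail L r0 zr aB al; rewrite zE.
  have := modulus_distl (psum a L (s%:C * w ^+ j)) l; rewrite modulusC.
  have := aM _ _ zE al; lra.
have cv := tail_cvg0 B q0 q1.
apply/ler_addgt0Pr => e e0; move/cvgr0Pnorm_lt : cv => /(_ _ e0) [n _ h].
have := bnd (maxn n k.+1) (leq_maxr _ _).
have := h (maxn n k.+1) (leq_maxl _ _) => /=.
rewrite ltr_norml; lra.
Qed.

Lemma has_psum_bounded_lt a (r : R) (F : R[i] -> R[i]) (s : R) : 0 <= s -> s < r ->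
  (forall z, modulus z < r -> has_psum a z (F z)) ->
  exists M, Cauchy_bound a s M.
Proof.
move=> s0 sr aF; have sE : modulus (s%:C : R[i]) = s by rewrite modulus_real ger0_norm.
by have := aF s%:C; rewrite sE => /(_ sr) /has_psum_bounded; rewrite sE.
Qed.

Lemma Cauchy_bound0 a (s : R) : 0 < s -> Cauchy_bound a s 0 -> forall k, a k = 0.
Proof.
move=> s0 a0 k; have := a0 k.
rewrite pmulr_lle0 ?exprn_gt0// => ak; apply/eqP.
by rewrite -modulus_eq0 eq_le ak modulus_ge0.
Qed.

(** Cauchy's estimate with bound [0] for the difference of the two series. *)
Lemma has_psum_inj a b (r : R) (F : R[i] -> R[i]) : 0 < r ->
  (forall z, modulus z < r -> has_psum a z (F z)) ->
  (forall z, modulus z < r -> has_psum b z (F z)) -> a = b.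
Proof.
move=> r0 aF bF; apply/funext => k; apply/eqP; rewrite -subr_eq0; apply/eqP.
have abF z : modulus z < r -> has_psum (fun k => a k - b k) z 0.
  by move=> zr; rewrite -(subrr (F z)); apply: has_psumB; [exact: aF|exact: bF].
have r2 : 0 <= r / 2 by lra.
have r2' : r / 2 < r by lra.
have [B aB] := has_psum_bounded_lt r2 r2' abF.
have r4 : 0 < r / 4 by lra.
apply: (@Cauchy_bound0 (fun k => a k - b k) _ r4).
apply: (Cauchy_estimate r4 _ aB); first by lra.
move=> z l zr al; have /abF al' : modulus z < r by rewrite zr; lra.
by rewrite (tends_unique al al') modulus0.
Qed.

End RootsOfUnity.

(** * Change of the centre of a power series *)

Section Recentering.
Context {R : realType}.
Implicit Types (a b : nat -> R[i]) (z w l : R[i]) (s r M : R).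

(** The coefficients of the [k]-th derivative divided by [k!]. *)
Definition divided_derivative k a m : R[i] := 'C(m + k, k)%:R * a (m + k)%N.

Lemma modulus_nat n : modulus (n%:R : R[i]) = n%:R.
Proof. by rewrite -(rmorph_nat (real_complex R)) modulus_real normr_nat. Qed.

(** One term of the binomial expansion of [(s + (r - s)) ^+ (m + k)] is compared with
    the whole. *)
Lemma divided_derivative_bound a k r s M : 0 <= s -> s < r ->
  Cauchy_bound a r M ->
  Cauchy_bound (divided_derivative k a) s (M / (r - s) ^+ k).
Proof.
move=> s0 sr aM m; have rs0 : 0 < r - s by rewrite subr_gt0.
rewrite ler_pdivlMr ?exprn_gt0// modulusM modulus_nat.
apply: le_trans (aM (m + k)%N).
rewrite (_ : _ * _ * _ * _ = modulus (a (m + k)%N) *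
    ((s ^+ m * (r - s) ^+ k) * 'C(m + k, k)%:R)); last by ring.
rewrite ler_wpM2l ?modulus_ge0//.
rewrite -[X in _ <= X ^+ _](_ : s + (r - s) = r); last by ring.
have kmk : (k < (m + k).+1)%N by rewrite ltnS leq_addl.
rewrite [leRHS]exprDn (bigD1 (Ordinal kmk)) //= addnK.
rewrite mulr_natr lerDl; apply: sumr_ge0 => i _.
by rewrite mulrn_wge0// mulr_ge0// exprn_ge0// ltW.
Qed.

(** The Taylor coefficients at [z1] of the sum of the series with coefficients
    [a]. *)
Definition recentered a z1 b : Prop :=
  forall k, has_psum (divided_derivative k a) z1 (b k).

Lemma recentered_exists a r M z1 : modulus z1 < r -> Cauchy_bound a r M ->
  exists b, recentered a z1 b.
Proof.
move=> z1r aM; have [s /andP[zs sr]] : exists s, modulus z1 < s < r.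
  by exists ((modulus z1 + r) / 2); apply/andP; split; lra.
have s0 := le_lt_trans (modulus_ge0 _) zs.
have /choice[b ab] : forall k, exists l, has_psum (divided_derivative k a) z1 l.
  move=> k.
  exact: has_psum_exists (divided_derivative_bound k (ltW s0) sr aM).
by exists b.
Qed.

Lemma recentered_bound a b r s M z1 : modulus z1 < s -> s < r ->
  Cauchy_bound a r M -> recentered a z1 b ->
  Cauchy_bound b (r - s) (M / (1 - modulus z1 / s)).
Proof.
move=> zs sr aM ab k; have s0 := le_lt_trans (modulus_ge0 _) zs.
have rs0 : 0 < r - s by rewrite subr_gt0.
rewrite -ler_pdivlMr ?exprn_gt0//.
have := has_psum_tail 0 s0 zs (divided_derivative_bound k (ltW s0) sr aM) (ab k).
by rewrite /psum big_ord0 subr0 expr0 mulr1 mulrAC.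
Qed.

(** The binomial formula for each power of [z1 + w], grouped by powers of [w]. *)
Lemma psum_recentered a L z1 w : psum a L (z1 + w) =
  \sum_(k < L) psum (divided_derivative k a) (L - k) z1 * w ^+ k.
Proof.
elim: L => [|L IH]; first by rewrite /psum !big_ord0.
rewrite psumS IH big_ord_recr /= subSnn.
rewrite [in RHS](eq_bigr (fun k : 'I_L => psum (divided_derivative k a) (L - k) z1 * w ^+ k +
   (divided_derivative k a (L - k) * z1 ^+ (L - k)) * w ^+ k)); last first.
  by move=> k _; rewrite subSn ?psumS ?mulrDl// ltnW.
rewrite big_split /= -addrA; congr (_ + _).
rewrite /psum big_ord1 /= exprDn mulr_sumr big_ord_recr /=.
rewrite subnn /divided_derivative add0n binn !mulr1n !expr0 !mulr1 !mul1r.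
congr (_ + _); apply: eq_bigr => k _; rewrite (subnK (ltnW (ltn_ord k))).
rewrite -mulr_natr; move: ('C(L, k)%:R : R[i]) (z1 ^+ _) (w ^+ _) => x y z.
by ring.
Qed.

Lemma geometric_partial_sum (x : R) n : 0 <= x -> x < 1 ->
  \sum_(k < n) x ^+ k <= (1 - x)^-1.
Proof.
move=> x0 x1; rewrite -[leRHS]mul1r ler_pdivlMr ?subr_gt0//.
rewrite -opprB mulrN mulrC -subrX1 opprB.
by rewrite lerBlDr lerDl exprn_ge0.
Qed.

(** Truncating both double series at total degree [L] gives the same finite sum,
    and what is left is dominated by a convolution of two geometric sequences. *)
Lemma recentered_sum a b r M z1 w l : Cauchy_bound a r M -> recentered a z1 b ->
  modulus w < r - modulus z1 -> has_psum a (z1 + w) l -> has_psum b w l.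
Proof.
move=> aM ab wr al.
have z10 := modulus_ge0 z1; have w0 := modulus_ge0 w.
have [s /andP[zs sr]] : exists s, modulus z1 < s < r - modulus w.
  by exists ((modulus z1 + (r - modulus w)) / 2); apply/andP; split; lra.
have s0 : 0 < s by lra.
have sr' : s < r by lra.
have rs0 : 0 < r - s by lra.
have [x xE] : exists x, x = modulus w / (r - s) by eexists.
have [y yE] : exists y, y = modulus z1 / s by eexists.
have x0 : 0 <= x by rewrite xE divr_ge0// ltW.
have x1 : x < 1 by rewrite xE ltr_pdivrMr// mul1r; lra.
have y0 : 0 <= y by rewrite yE divr_ge0// ltW.
have y1 : y < 1 by rewrite yE ltr_pdivrMr// mul1r.
(* A ratio strictly above [x] and at least [y], so that the convolution of
   [x ^+ k] with [y ^+ k] is still dominated by a geometric sequence. *)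
have [p /and4P[p0 xp yp p1]] : exists p, [&& 0 < p, x < p, y <= p & p < 1].
  have [xy|yx] := leP x y.
    by exists ((1 + y) / 2); apply/and4P; split; lra.
  by exists ((1 + x) / 2); apply/and4P; split; lra.
have M0 := Cauchy_bound_ge0 aM.
pose C := M / (1 - y) * (1 - x / p)^-1.
have xp0 : 0 <= x / p by rewrite divr_ge0// ltW.
have xp1 : x / p < 1 by rewrite ltr_pdivrMr// mul1r.
have key L : modulus (psum b L w - psum a L (z1 + w)) <= C * p ^+ L.
  rewrite psum_recentered /psum -sumrB; apply: le_trans (modulus_sum _ _ _) _.
  apply: (@le_trans _ _ (\sum_(k < L) (M / (1 - y) * p ^+ L) * (x / p) ^+ k)).
    apply: ler_sum => k _; rewrite -mulrBl modulusM modulusX.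
    have H := has_psum_tail (L - k) s0 zs
      (divided_derivative_bound k (ltW s0) sr' aM) (ab k).
    rewrite -yE in H.
    have -> : modulus w = x * (r - s) by rewrite xE divfK ?gt_eqF.
    apply: (@le_trans _ _
        (M / (r - s) ^+ k * y ^+ (L - k) / (1 - y) * (x * (r - s)) ^+ k)).
      apply: ler_wpM2r H.
      by rewrite exprn_ge0// mulr_ge0// ltW.
    have -> : M / (r - s) ^+ k * y ^+ (L - k) / (1 - y) * (x * (r - s)) ^+ k =
        M / (1 - y) * (y ^+ (L - k) * x ^+ k).
      have : (r - s) ^+ k != 0 by rewrite expf_neq0 ?gt_eqF.
      rewrite exprMn; move: ((r - s) ^+ k) (y ^+ _) (x ^+ k) => D Y X D0.
      by field; rewrite D0 subr_eq0 gt_eqF.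
    rewrite -[leRHS]mulrA; apply: ler_wpM2l.
      by rewrite divr_ge0// subr_ge0 ltW.
    have -> : p ^+ L * (x / p) ^+ k = p ^+ (L - k) * x ^+ k.
      have -> : p ^+ L = p ^+ (L - k) * p ^+ k.
        by rewrite -exprD subnK// ltnW.
      rewrite exprMn exprVn.
      rewrite -mulrA; congr (_ * _).
      by rewrite mulrC divfK// expf_neq0// gt_eqF.
    by rewrite ler_wpM2r ?exprn_ge0// lerXn2r ?nnegrE// ltW.
  rewrite -mulr_sumr /C [leRHS]mulrAC.
  apply: ler_wpM2l; last exact: geometric_partial_sum.
  by rewrite mulr_ge0 ?exprn_ge0 ?divr_ge0 ?subr_ge0 // ltW.
have d0 : tends (fun L => psum b L w - psum a L (z1 + w)) 0.
  apply: (@tends_squeeze _ _ _ (fun L => C * p ^+ L)).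
    by apply: nearW => L; rewrite subr0.
  rewrite -(mulr0 C); apply: cvgMr; apply: cvg_expr.
  by rewrite ger0_norm ?ltW.
have := tendsD d0 al; rewrite add0r; congr tends; apply/funext => L.
by rewrite subrK.
Qed.

End Recentering.

(** * Uniformity of the local expansions *)

Section GlobalExpansion.
Context {R : realType}.
Implicit Types (a b : nat -> R[i]) (z w l : R[i]) (f : R[i] -> R[i]).
Implicit Types (s r d M : R).

Definition expands_at f z a d : Prop :=
  forall w, modulus w < d -> has_psum a w (f (z + w)).

Lemma analytic_onP (U : set R[i]) f : analytic_on U f <->
  (forall z, U z -> exists a d, 0 < d /\ expands_at f z a d).
Proof.
split=> H z Uz.
  have [r [a [r0 aP]]] := H z Uz; exists a, r; split=> // w wr.
  have /aP : modulus (z + w - z) < r by rewrite addrC addKr.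
  by rewrite has_psum_seriesP addrC addKr addrC.
have [a [d [d0 aP]]] := H z Uz; exists d, a; split=> // w wd.
by apply/has_psum_seriesP; rewrite -[in f w](subrKC z w); exact: aP.
Qed.

Definition expands_uniformly f z d M : Prop :=
  exists b, Cauchy_bound b d M /\ expands_at f z b d.

Lemma expands_uniformlyW f z d d' M M' : 0 <= d' -> d' <= d -> M <= M' ->
  expands_uniformly f z d M -> expands_uniformly f z d' M'.
Proof.
move=> d0 dd MM [b [bM bf]]; exists b; split.
  by move=> k; apply: le_trans (Cauchy_boundW d0 dd bM k) MM.
by move=> w wd; apply: bf; apply: lt_le_trans dd.
Qed.

(** Recentering inside the disc of convergence at [z0] keeps a fixed fraction of
    the radius and at most doubles the bound, whatever the new centre. *)
Lemma expands_locally_uniformly f z0 a r : 0 < r -> expands_at f z0 a r ->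
  exists d M, 0 < d /\
    forall z, modulus (z - z0) < d -> expands_uniformly f z d M.
Proof.
move=> r0 af.
have [M aM] : exists M, Cauchy_bound a (r / 2) M.
  by apply: (@has_psum_bounded_lt _ a r (fun w => f (z0 + w))) => //; lra.
exists (r / 8), (2 * M); split; first lra.
move=> z zz0; set z1 := z - z0.
have z10 := modulus_ge0 z1.
have M0 := Cauchy_bound_ge0 aM.
have z1r2 : modulus z1 < r / 2 by rewrite /z1; lra.
have [b ab] := recentered_exists z1r2 aM.
have z1r4 : modulus z1 < r / 4 by rewrite /z1; lra.
have r42 : r / 4 < r / 2 by lra.
exists b; split.
  have r8 : 0 <= r / 8 by lra.
  have r8' : r / 8 <= r / 2 - r / 4 by lra.
  move=> k; apply: le_trans (Cauchy_boundW r8 r8' (recentered_bound z1r4 r42 aM ab) k) _.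
  have r40 : 0 < r / 4 by lra.
  have q1 : modulus z1 / (r / 4) <= 2^-1 by rewrite ler_pdivrMr// /z1; lra.
  rewrite ler_pdivrMr; last by lra.
  by move: (modulus z1 / _) q1 => q q1; nra.
move=> w wr; apply: (recentered_sum aM ab); first by rewrite /z1; lra.
have -> : z + w = z0 + (z1 + w) by rewrite /z1; ring.
by apply: af; apply: le_lt_trans (modulusD _ _) _; rewrite /z1; lra.
Qed.

Lemma near_modulus (p : R * R) (e : R) : 0 < e ->
  \forall q \near p, modulus ((q.1 +i* q.2) - (p.1 +i* p.2)) < e.
Proof.
move=> e0; have e2 : 0 < e / 2 by lra.
have : \forall q \near p, ball p (e / 2) q by apply: nbhsx_ballx.
apply: filterS => q [h1 h2].
have := modulus_le_ReIm ((q.1 +i* q.2) - (p.1 +i* p.2)).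
move: h1 h2; rewrite /ball /= (distrC p.1) (distrC p.2).
lra.
Qed.

(** Compactness of a square that contains the closed disc, applied to the property
    of having an expansion with radius [n.+1%:R^-1] and bound [n.+1%:R]: it is local
    by [expands_locally_uniformly] and monotone in [n]. *)
Lemma expands_uniformly_compact f (rho : R) : rho < 1 ->
  analytic_on unit_disc f ->
  exists d M, 0 < d /\ forall z, modulus z <= rho -> expands_uniformly f z d M.
Proof.
move=> rho1 /analytic_onP fan.
pose S := `[(-1 : R), 1]%classic `*` `[(-1 : R), 1]%classic.
have cS : compact S by apply: compact_setX; exact: segment_compact.
pose P n (p : R * R) := modulus (p.1 +i* p.2) <= rho ->
  expands_uniformly f (p.1 +i* p.2) n.+1%:R^-1 n.+1%:R.
have : \forall n \near \oo, S `<=` P n.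
  move/compact_near_coveringP : cS; apply => p _.
  have [p1|p1] := ltP (modulus (p.1 +i* p.2)) 1.
    have [a [r [r0 af]]] := fan _ p1.
    have [d [M [d0 dM]]] := expands_locally_uniformly r0 af.
    have hN : \forall n \near \oo, d^-1 <= n%:R /\ M <= n%:R.
      by apply: filterI; exact: nbhs_infty_ger.
    exists ([set q : R * R | modulus ((q.1 +i* q.2) - (p.1 +i* p.2)) < d],
            [set n | d^-1 <= n%:R /\ M <= n%:R]).
      by split; [exact: near_modulus|exact: hN].
    move=> [q n] /= [qd [dn Mn]] _; apply: (expands_uniformlyW _ _ _ (dM _ qd)).
    - by rewrite invr_ge0.
    - rewrite -[leRHS]invrK lef_pV2 ?posrE ?invr_gt0// (le_trans dn)// ler_nat.
      exact: leqnSn.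
    - by rewrite (le_trans Mn)// ler_nat leqnSn.
  (* A point outside the open disc has a neighbourhood that misses the closed
     disc of radius [rho]. *)
  exists ([set q : R * R | modulus ((q.1 +i* q.2) - (p.1 +i* p.2)) < 1 - rho],
          setT).
    by split; [apply: near_modulus; lra|exact: filterT].
  move=> [q n] /= [qd _] qr; exfalso.
  have := modulus_distl (p.1 +i* p.2) (q.1 +i* q.2); rewrite modulusC; lra.
move=> [n _ /(_ _ (leqnn n)) nP]; exists n.+1%:R^-1, n.+1%:R.
split; first by rewrite invr_gt0.
move=> z zrho; have z1 : modulus z <= 1 by lra.
have /nP : S (complex.Re z, complex.Im z).
  have := norm_Re_le z; have := norm_Im_le z; rewrite /S /= !in_itv /= -!ler_norml.
  by move=> h1 h2; split; [exact: le_trans z1|exact: le_trans z1].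
by rewrite /P /=; case: z zrho {z1} => x y /= zrho; apply.
Qed.

End GlobalExpansion.

(** * The expansion at the centre represents the function on the disc *)

Section LocalToGlobal.
Context {R : realType}.
Implicit Types (a b : nat -> R[i]) (z w l : R[i]) (f : R[i] -> R[i]).
Implicit Types (s r d M : R).

(** Where both exist, the expansion of [f] at [z] is the recentered one, so the
    bounds known for the former apply to the latter. *)
Lemma recentered_expansion f a b r s d z : modulus z < s -> s < r -> 0 < d ->
  expands_at f 0 a r -> expands_at f z b d -> recentered a z b.
Proof.
move=> zs sr d0 af bf.
have s0 := le_lt_trans (modulus_ge0 _) zs.
have [M aM] : exists M, Cauchy_bound a s M.
  by apply: (@has_psum_bounded_lt _ a r (fun w => f (0 + w))) => //; exact: ltW.
have [b' ab'] := recentered_exists zs aM.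
suff -> : b = b' by [].
have [e [e0 ed es]] : exists e, [/\ 0 < e, e <= d & e <= s - modulus z].
  exists (Num.min d (s - modulus z)).
  by rewrite lt_min d0 subr_gt0 zs !ge_min !lexx orbT.
apply: (@has_psum_inj _ _ _ _ (fun w => f (z + w)) e0) => w we.
  by apply: bf; exact: lt_le_trans ed.
apply: (recentered_sum aM ab'); first exact: lt_le_trans es.
have := af (z + w); rewrite add0r; apply.
by have := modulusD z w; lra.
Qed.

(** The coefficient [a l] occurs in every divided derivative of order at most [l].
    Weighting Cauchy's estimates for these by powers of [d / 2] and summing, the
    binomial formula turns the uniform bounds at the points of modulus [s] into
    one on the larger circle of radius [s + d / 2]. *)
Lemma Cauchy_bound_extend f a r s d M : 0 < s -> s < r -> 0 < d ->
  expands_at f 0 a r ->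
  (forall z, modulus z = s -> expands_uniformly f z d M) ->
  Cauchy_bound a (s + d / 2) (2 * M).
Proof.
move=> s0 sr d0 af fM.
have [t /andP[st tr]] : exists t, s < t < r.
  by exists ((s + r) / 2); apply/andP; split; lra.
have [t' /andP[tt tr']] : exists t', t < t' < r.
  by exists ((t + r) / 2); apply/andP; split; lra.
have t0 : 0 <= t' by lra.
have [B aB] : exists B, Cauchy_bound a t' B.
  by apply: (@has_psum_bounded_lt _ a r (fun w => f (0 + w))).
have est k : Cauchy_bound (divided_derivative k a) s (M / d ^+ k).
  have t1 : 0 <= t by lra.
  apply: (Cauchy_estimate s0 st (divided_derivative_bound k t1 tt aB)).
  move=> z l zs al; have [b [bM bf]] := fM z zs.
  have zt : modulus z < t by rewrite zs.
  have := recentered_expansion zt tr d0 af bf => /(_ k) al'.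
  by rewrite (tends_unique al al') ler_pdivlMr ?exprn_gt0.
have M0 : 0 <= M by have := Cauchy_bound_ge0 (est 0%N); rewrite expr0 divr1.
move=> l.
have -> : modulus (a l) * (s + d / 2) ^+ l =
    \sum_(k < l.+1) (modulus (divided_derivative k a (l - k)) * s ^+ (l - k)) *
       (d ^+ k * 2^-1 ^+ k).
  rewrite exprDn mulr_sumr; apply: eq_bigr => k _.
  rewrite /divided_derivative modulusM modulus_nat subnK; last by rewrite -ltnS.
  rewrite -mulr_natl exprMn.
  move: ('C(l, k)%:R : R) (modulus (a l)) (s ^+ _) (d ^+ k) (2^-1 ^+ k).
  by move=> x1 x2 x3 x4 x5; ring.
apply: (@le_trans _ _ (\sum_(k < l.+1) M * 2^-1 ^+ k)).
  apply: ler_sum => k _; rewrite mulrA ler_wpM2r ?exprn_ge0 ?invr_ge0//.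
  by have := est k (l - k)%N; rewrite ler_pdivlMr ?exprn_gt0.
rewrite -mulr_sumr mulrC ler_wpM2r//.
have h0 : 0 <= 2^-1 :> R by lra.
have h1 : 2^-1 < 1 :> R by lra.
apply: le_trans (geometric_partial_sum l.+1 h0 h1) _.
by rewrite (_ : 1 - 2^-1 = 2^-1) ?invrK//; lra.
Qed.

Lemma expansion_extend f a r : analytic_on unit_disc f -> 0 < r -> r < 1 ->
  expands_at f 0 a r -> exists r', r < r' /\ expands_at f 0 a r'.
Proof.
move=> fan r0 r1 af.
have [d1 [M [d10 fM1]]] := expands_uniformly_compact r1 fan.
have [d [d0 dr dd]] : exists d, [/\ 0 < d, d <= r & d <= d1].
  by exists (Num.min r d1); rewrite lt_min r0 d10 !ge_min !lexx orbT.
have fM z : modulus z <= r -> expands_uniformly f z d M.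
  by move=> /fM1; apply: expands_uniformlyW => //; exact: ltW.
have [s sE] : exists s, s = r - d / 4 by eexists.
have s0 : 0 < s by lra.
have sr : s < r by lra.
have fMs z : modulus z = s -> expands_uniformly f z d M.
  by move=> zs; apply: fM; rewrite zs; exact: ltW.
have aM := Cauchy_bound_extend s0 sr d0 af fMs.
exists (s + d / 2); split; first by lra.
move=> z zr; have [|rz] := ltP (modulus z) r; first exact: af.
have z0 : 0 < modulus z by lra.
(* The point of modulus [s] on the ray through [z]: its distance to [z] is less
   than [d / 2], so the local expansion there reaches [z]. *)
have [z1 z1E] : exists z1, z1 = z * (s / modulus z)%:C by eexists.
have z1s : modulus z1 = s.
  rewrite z1E modulusM modulus_real ger0_norm ?divr_ge0 ?ltW//.
  by rewrite mulrC divfK ?gt_eqF.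
have zz1 : modulus (z - z1) = modulus z - s.
  have -> : z - z1 = z * (1 - s / modulus z)%:C.
    by rewrite z1E rmorphB /= rmorph1 mulrBr mulr1.
  rewrite modulusM modulus_real ger0_norm; first by field; rewrite gt_eqF.
  by rewrite subr_ge0 ler_pdivrMr// mul1r; lra.
have [b [bM bf]] := fMs z1 z1s.
have [t /andP[st tr]] : exists t, s < t < r.
  by exists ((s + r) / 2); apply/andP; split; lra.
have z1t : modulus z1 < t by rewrite z1s.
have ab := recentered_expansion z1t tr d0 af bf.
have zE : z1 + (z - z1) = z by rewrite subrKC.
have s1 : 0 < s + d / 2 by lra.
have [l al] := has_psum_exists s1 zr aM.
have bl : has_psum b (z - z1) l.
  apply: (recentered_sum aM ab); last by rewrite zE.
  by rewrite zz1 z1s; lra.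
have : has_psum b (z - z1) (f (z1 + (z - z1))) by apply: bf; rewrite zz1; lra.
by rewrite zE add0r => /(tends_unique bl) <-.
Qed.

(** An analytic function on the disc is the sum of its expansion at the centre:
    otherwise the radius of the largest disc on which this holds would be less
    than [1], and the expansion would extend further. *)
Lemma analytic_expansion f : analytic_on unit_disc f ->
  exists a, expands_at f 0 a 1.
Proof.
move=> fan; have /analytic_onP/(_ 0) := fan.
rewrite /unit_disc /= modulus0 => /(_ ltr01)[a [d [d0 af]]]; exists a.
pose E := [set r : R | 0 < r <= 1 /\ expands_at f 0 a r].
have E0 : E (Num.min d 1).
  split; first by rewrite lt_min d0 ltr01 ge_min lexx orbT.
  by move=> w wd; apply: af; apply: lt_le_trans wd _; rewrite ge_min lexx.
have ubE : ubound E 1 by move=> r [/andP[]].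
have hE : has_sup E by split; [exists (Num.min d 1)|exists 1].
have supE1 : sup E <= 1 by apply: ge_sup => //; exists (Num.min d 1).
have supE0 : 0 < sup E.
  apply: (@lt_le_trans _ _ (Num.min d 1)); first by rewrite lt_min d0 ltr01.
  by apply: ub_le_sup => //; exists 1.
have supE : expands_at f 0 a (sup E).
  move=> w wE; have e0 : 0 < sup E - modulus w by rewrite subr_gt0.
  have [r [_ af'] wr] := sup_adherent e0 hE.
  by apply: af'; move: wr; rewrite opprB addrC subrK.
have [sup1|sup1] := ltP (sup E) 1; last first.
  by move=> w w1; apply: supE; exact: lt_le_trans sup1.
have [r' [rr' af']] := expansion_extend fan supE0 sup1 supE.
have : E (Num.min r' 1).
  split.
    by rewrite lt_min ltr01 (lt_trans supE0 rr') ge_min lexx orbT.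
  by move=> w wd; apply: af'; apply: lt_le_trans wd _; rewrite ge_min lexx.
move=> /(ub_le_sup _) => /(_ (ex_intro _ 1 ubE)).
by rewrite leNgt lt_min rr' sup1.
Qed.

Lemma expansion_analytic f a : expands_at f 0 a 1 -> analytic_on unit_disc f.
Proof.
move=> af; apply/analytic_onP => z; rewrite /unit_disc /= => z1.
have [s /andP[zs s1]] : exists s, modulus z < s < 1.
  by exists ((modulus z + 1) / 2); apply/andP; split; lra.
have s0 : 0 <= s by have := modulus_ge0 z; lra.
have [M aM] : exists M, Cauchy_bound a s M.
  by apply: (@has_psum_bounded_lt _ a 1 (fun w => f (0 + w))).
have [b ab] := recentered_exists zs aM.
exists b, (s - modulus z); split; first by rewrite subr_gt0.
move=> w ws; apply: (recentered_sum aM ab) => //.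
have := af (z + w); rewrite add0r; apply.
by have := modulusD z w; lra.
Qed.

End LocalToGlobal.

(** * Rotation invariance of the area measure *)

Section PlaneMeasure.
Context {R : realType}.
Local Notation mu := (@lebesgue_measure R).
Local Notation mu2 := (@lebesgue_measure R \x @lebesgue_measure R)%E.
Local Open Scope ereal_scope.

Lemma lebesgue_measure_translation (t : R) (A : set R) : measurable A ->
  pushforward mu ((fun x => x + t)%R : _ -> measurableTypeR R) A = mu A.
Proof.
have mt : measurable_fun setT ((fun x => x + t)%R : R -> measurableTypeR R).
  exact: measurable_funD.
move=> mA; apply/esym/lebesgue_measure_unique => //= _ [[a b]] _ <-.
rewrite /pushforward (_ : _ @^-1` _ = `](a - t)%R, (b - t)%R]%classic).
  rewrite !lebesgue_measure_itv/= !lte_fin ltrD2r.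
  by case: ifP => // _; rewrite -!EFinD; congr EFin; ring.
by apply/seteqP; split=> x /=; rewrite !in_itv/= ltrBlDr lerBrDr.
Qed.

Lemma integral_translation (t : R) (h : R -> \bar R) : measurable_fun setT h ->
  (forall x, 0 <= h x) -> \int[mu]_x h (x + t)%R = \int[mu]_x h x.
Proof.
move=> mh h0.
have mt : measurable_fun setT ((fun x => x + t)%R : R -> measurableTypeR R).
  exact: measurable_funD.
transitivity (\int[pushforward mu ((fun x => x + t)%R : _ -> measurableTypeR R)]_y h y).
  by rewrite ge0_integral_pushforward.
by apply: eq_measure_integral => A mA _; exact: lebesgue_measure_translation.
Qed.

Lemma measurable_shear1 (t : R) :
  measurable_fun setT (fun p : R * R => (p.1 + t * p.2, p.2)%R).
Proof.
apply: measurable_fun_pair => //; apply: measurable_funD => //.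
by apply: measurable_funM => //; exact: measurable_cst.
Qed.

Lemma measurable_shear2 (t : R) :
  measurable_fun setT (fun p : R * R => (p.1, p.2 + t * p.1)%R).
Proof.
apply: measurable_fun_pair => //; apply: measurable_funD => //.
by apply: measurable_funM => //; exact: measurable_cst.
Qed.

Lemma integral_shear1 (t : R) (h : R * R -> \bar R) : measurable_fun setT h ->
  (forall p, 0 <= h p) ->
  \int[mu2]_p h (p.1 + t * p.2, p.2)%R = \int[mu2]_p h p.
Proof.
move=> mh h0; rewrite !fubini_tonelli2//; last first.
  exact: (measurableT_comp mh (measurable_shear1 t)).
apply: eq_integral => y _; rewrite /fubini_G /=.
apply: (@integral_translation (t * y)%R (fun x => h (x, y))) => //.
exact: measurable_fun_pair1.
Qed.

Lemma integral_shear2 (t : R) (h : R * R -> \bar R) : measurable_fun setT h ->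
  (forall p, 0 <= h p) ->
  \int[mu2]_p h (p.1, p.2 + t * p.1)%R = \int[mu2]_p h p.
Proof.
move=> mh h0; rewrite !fubini_tonelli1//; last first.
  exact: (measurableT_comp mh (measurable_shear2 t)).
apply: eq_integral => x _; rewrite /fubini_F /=.
apply: (@integral_translation (t * x)%R (fun y => h (x, y))) => //.
exact: measurable_fun_pair2.
Qed.

(** A rotation is a product of three shears, unless it is the half turn, and shears
    preserve the product measure by Tonelli's theorem and translation invariance
    on the line. *)
Lemma integral_rotation (c s : R) (h : R * R -> \bar R) :
  (c ^+ 2 + s ^+ 2 = 1)%R -> (c != -1)%R ->
  measurable_fun setT h -> (forall p, 0 <= h p) ->
  \int[mu2]_p h (c * p.1 - s * p.2, s * p.1 + c * p.2)%R = \int[mu2]_p h p.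
Proof.
(* [t] is minus the tangent of half the angle. *)
move=> cs c1 mh h0; pose t := (- s / (1 + c))%R.
have c10 : (1 + c != 0)%R by rewrite addrC addr_eq0.
have m1 := measurableT_comp mh (measurable_shear1 t).
have m2 := measurableT_comp m1 (measurable_shear2 s).
rewrite -(integral_shear1 t mh h0).
rewrite -(integral_shear2 s m1 (fun p => h0 _)).
rewrite -(integral_shear1 t m2 (fun p => h0 _)).
apply: eq_integral => -[x y] _ /=.
have st : (1 + s * t = c)%R.
  have s2 : (s ^+ 2 = (1 + c) * (1 - c))%R by rewrite -[LHS](addKr (c ^+ 2)%R) cs; ring.
  by rewrite /t mulrA mulrN -expr2 s2; field.
have tc : (t * (1 + c) = - s)%R by rewrite /t divfK.
have -> : (c * x - s * y = (1 + s * t) * x + t * (1 + (1 + s * t)) * y)%R.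
  by rewrite st tc mulNr.
by rewrite -[c in (s * x + c * y)%R]st; congr (h (_, _)); ring.
Qed.

End PlaneMeasure.

(** * Mean squares of power series *)

Section Energy.
Context {R : realType}.
Local Notation mu := (@lebesgue_measure R).
Local Notation mu2 := (@lebesgue_measure R \x @lebesgue_measure R)%E.
Implicit Types (a b : nat -> R[i]) (f : R[i] -> R[i]) (F : R * R -> R[i]).

Definition disc (r : R) : set (R * R) :=
  [set p | modulus (p.1 +i* p.2) < r].

Definition ring_domain (r s : R) : set (R * R) :=
  [set p | r <= modulus (p.1 +i* p.2) < s].

(** On [disc 1] this is [pi] times the square of the Bergman norm. *)
Definition energy (D : set (R * R)) f : \bar R :=
  (\int[mu2]_(p in D) (modulus (f (p.1 +i* p.2)) ^+ 2)%:E)%E.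

Definition complex_measurable F : Prop :=
  measurable_fun setT (fun p => complex.Re (F p)) /\
  measurable_fun setT (fun p => complex.Im (F p)).

Lemma complex_measurable_id : complex_measurable (fun p => p.1 +i* p.2).
Proof. by split; [exact: measurable_fst|exact: measurable_snd]. Qed.

Lemma complex_measurable_cst z : complex_measurable (fun=> z).
Proof. by split; exact: measurable_cst. Qed.

Lemma complex_measurableD F G : complex_measurable F -> complex_measurable G ->
  complex_measurable (fun p => F p + G p).
Proof.
move=> [Fr Fi] [Gr Gi]; split.
  rewrite (_ : (fun _ => _) = (fun p => complex.Re (F p)) \+ (fun p => complex.Re (G p))).
    exact: measurable_funD.
  by apply/funext => p /=; case: (F p) (G p) => ? ? [].
rewrite (_ : (fun _ => _) = (fun p => complex.Im (F p)) \+ (fun p => complex.Im (G p))).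
  exact: measurable_funD.
by apply/funext => p /=; case: (F p) (G p) => ? ? [].
Qed.

Lemma complex_measurableM F G : complex_measurable F -> complex_measurable G ->
  complex_measurable (fun p => F p * G p).
Proof.
move=> [Fr Fi] [Gr Gi]; split.
  rewrite (_ : (fun _ => _) =
      (fun p => complex.Re (F p)) \* (fun p => complex.Re (G p)) \-
      (fun p => complex.Im (F p)) \* (fun p => complex.Im (G p))).
    by apply: measurable_funB; exact: measurable_funM.
  by apply/funext => p /=; case: (F p) (G p) => ? ? [].
rewrite (_ : (fun _ => _) =
    (fun p => complex.Re (F p)) \* (fun p => complex.Im (G p)) \+
    (fun p => complex.Im (F p)) \* (fun p => complex.Re (G p))).
  by apply: measurable_funD; exact: measurable_funM.
by apply/funext => p /=; case: (F p) (G p) => ? ? [].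
Qed.

Lemma complex_measurable_psum a n F : complex_measurable F ->
  complex_measurable (fun p => psum a n (F p)).
Proof.
move=> mF; have mX k : complex_measurable (fun p => F p ^+ k).
  elim: k => [|k IH].
    by under eq_fun do rewrite expr0; exact: complex_measurable_cst.
  by under eq_fun do rewrite exprS; exact: complex_measurableM.
elim: n => [|n IH].
  by under eq_fun do rewrite /psum big_ord0; exact: complex_measurable_cst.
under eq_fun do rewrite psumS; apply: complex_measurableD => //.
by apply: complex_measurableM => //; exact: complex_measurable_cst.
Qed.

Lemma measurable_modulus_sqr F : complex_measurable F ->
  measurable_fun setT (fun p => modulus (F p) ^+ 2).
Proof.
move=> [Fr Fi]; under eq_fun do rewrite modulus_sqr.
by apply: measurable_funD; exact: measurable_funX.
Qed.

Lemma measurable_disc r : measurable (disc r).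
Proof.
have [r0|r0] := ltP r 0.
  rewrite (_ : disc r = set0)//; apply/seteqP; split=> // p.
  by rewrite /disc /= => /lt_trans /(_ r0); rewrite ltNge modulus_ge0.
have m := measurable_modulus_sqr complex_measurable_id.
have := m measurableT _ (measurable_itv `]-oo, (r ^+ 2)[); rewrite setTI.
rewrite (_ : _ @^-1` _ = disc r)//; apply/seteqP.
split=> p; rewrite /disc /= in_itv /=.
  by rewrite ltr_pXn2r ?nnegrE ?modulus_ge0.
by move=> h; rewrite ltr_pXn2r ?nnegrE ?modulus_ge0.
Qed.

Lemma ring_domainE r s : ring_domain r s = disc s `\` disc r.
Proof.
apply/seteqP; split=> p; rewrite /ring_domain /disc /=.
  by move=> /andP[rp ps]; split=> //; apply/negP; rewrite -leNgt.
by move=> [ps /negP]; rewrite -leNgt ps => ->.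
Qed.

Lemma measurable_ring_domain r s : measurable (ring_domain r s).
Proof. by rewrite ring_domainE; apply: measurableD; exact: measurable_disc. Qed.

Lemma measurable_expansion f a : expands_at f 0 a 1 ->
  measurable_fun (disc 1) (fun p => modulus (f (p.1 +i* p.2)) ^+ 2).
Proof.
move=> af; apply: (@measurable_fun_cvg _ _ _ _
    (fun n p => modulus (psum a n (p.1 +i* p.2)) ^+ 2)).
  move=> n; apply: measurable_funS (measurable_modulus_sqr _) => //.
  exact: complex_measurable_psum complex_measurable_id.
move=> p p1; have := af _ p1; rewrite add0r => /tends_modulus h.
by rewrite expr2; under eq_fun do rewrite expr2; exact: cvgM.
Qed.

Lemma energy_ge0 D f : (0 <= energy D f)%E.
Proof. by apply: integral_ge0 => p _; rewrite lee_fin sqr_ge0. Qed.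

Lemma sum_sqr_le N (x : 'I_N -> R) :
  (\sum_j x j) ^+ 2 <= N%:R * \sum_j x j ^+ 2.
Proof.
have [N0|N0] := eqVneq N 0%N.
  by subst N; rewrite !big_ord0 expr0n mulr0.
set S := \sum_j x j.
have : 0 <= \sum_j (N%:R * x j - S) ^+ 2 by apply: sumr_ge0 => j _; exact: sqr_ge0.
rewrite (eq_bigr (fun j => N%:R ^+ 2 * x j ^+ 2 + (- 2 * N%:R * S) * x j + S ^+ 2));
  last by move=> j _; ring.
rewrite 2!big_split /= -!mulr_sumr sumr_const card_ord -/S -(mulr_natl S).
rewrite (_ : _ + _ + _ = N%:R * (N%:R * \sum_j x j ^+ 2 - S ^+ 2)); last by ring.
rewrite pmulr_rge0 ?subr_ge0//.
by rewrite ltr0n lt0n.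
Qed.


Lemma energyS D D' f : measurable D -> measurable D' -> D `<=` D' ->
  measurable_fun D' (fun p => modulus (f (p.1 +i* p.2)) ^+ 2) ->
  (energy D f <= energy D' f)%E.
Proof.
move=> mD mD' DD' mf; apply: ge0_subset_integral => //.
  exact/measurable_EFinP.
by move=> p _; rewrite lee_fin sqr_ge0.
Qed.

Lemma integral_disc_rotation (c s r : R) (g : R * R -> \bar R) :
  c ^+ 2 + s ^+ 2 = 1 -> c != -1 -> measurable_fun setT g ->
  (forall p, (0 <= g p)%E) ->
  (\int[mu2]_(p in disc r) g (c * p.1 - s * p.2, s * p.1 + c * p.2)%R =
   \int[mu2]_(p in disc r) g p)%E.
Proof.
move=> cs c1 mg g0.
have rotE (p : R * R) : modulus ((c * p.1 - s * p.2) +i* (s * p.1 + c * p.2)) =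
    modulus (p.1 +i* p.2).
  apply/eqP; rewrite -(eqrXn2 (n := 2)) ?modulus_ge0// !modulus_sqr /=.
  rewrite -[p.1 ^+ 2 + p.2 ^+ 2]mul1r -cs; apply/eqP; ring.
rewrite integral_mkcond [RHS]integral_mkcond.
have mh : measurable_fun setT (g \_ (disc r)).
  apply/(measurable_restrictT _ (measurable_disc r)).
  exact: measurable_funS mg.
have h0 p : (0 <= (g \_ (disc r)) p)%E.
  by rewrite patchE; case: ifP.
rewrite -(integral_rotation cs c1 mh h0); apply: eq_integral => p _.
rewrite !patchE; congr (if _ then _ else _).
apply/idP/idP; rewrite !inE /disc /=.
  by rewrite rotE.
by rewrite rotE.
Qed.

Lemma energy_rotation a n (w : R[i]) r : modulus w = 1 -> w != -1 ->
  energy (disc r) (fun z => psum a n (z * w)) = energy (disc r) (psum a n).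
Proof.
case: w => c s w1 wN1.
have cs : c ^+ 2 + s ^+ 2 = 1.
  by have := modulus_sqr (c +i* s); rewrite w1 expr1n.
have c1 : c != -1.
  apply: contra wN1 => /eqP cE; move: cs; rewrite cE sqrrN expr1n => /eqP.
  by rewrite addrC -subr_eq0 addrK sqrf_eq0 => /eqP ->; rewrite eq_complex /= oppr0 !eqxx.
have mh : measurable_fun setT
    (fun p : R * R => (modulus (psum a n (p.1 +i* p.2)) ^+ 2)%:E).
  apply/measurable_EFinP; apply: measurable_modulus_sqr.
  exact: complex_measurable_psum complex_measurable_id.
have h0 (p : R * R) : (0 <= (modulus (psum a n (p.1 +i* p.2)) ^+ 2)%:E)%E.
  by rewrite lee_fin sqr_ge0.
apply: etrans (integral_disc_rotation r cs c1 mh h0).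
apply: eq_integral => p _ /=; congr ((modulus (psum a n _) ^+ 2)%:E).
by apply/eqP; rewrite eq_complex /=; apply/andP; split; apply/eqP; ring.
Qed.

(** The average over the [N]-th roots of unity of the squared modulus of a
    polynomial dominates the squared modulus of each of its monomials, and has the
    same integral over a disc as the squared modulus of the polynomial.  For [N]
    odd the half turn, which is not a product of three shears, does not occur. *)
Lemma energy_psum_coef a k L (r s : R) : (k < L)%N -> 0 <= r ->
  (((modulus (a k) * r ^+ k) ^+ 2)%:E * mu2 (ring_domain r s) <=
   energy (disc s) (psum a L))%E.
Proof.
move=> kL r0; pose N := L.*2.+1.
have N0 : (0 < N)%N by [].
have LN : (L <= N)%N by rewrite /N -addnn; lia.
have [w wN] := primitive_root_exists (R := R) N0.
have w1 := modulus_root N0 (prim_expr_order wN).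
have wN1 j : w ^+ j != -1.
  apply/eqP => E; have : (w ^+ j) ^+ N = 1.
    by rewrite exprAC (prim_expr_order wN) expr1n.
  rewrite E -signr_odd /N /= odd_double /= => /eqP.
  by rewrite expr1 eqNr oner_eq0.
have mR := measurable_ring_domain r s.
have mD := measurable_disc s.
have mP j : measurable_fun setT
    (fun p : R * R => (modulus (psum a L ((p.1 +i* p.2) * w ^+ j)) ^+ 2)%:E).
  apply/measurable_EFinP; apply: measurable_modulus_sqr.
  apply: complex_measurable_psum; apply: complex_measurableM.
    exact: complex_measurable_id.
  exact: complex_measurable_cst.
have [X XE] : exists X, X = modulus (a k) * r ^+ k by eexists.
rewrite -XE; have X0 : 0 <= X by rewrite XE mulr_ge0 ?modulus_ge0 ?exprn_ge0.
have point p : ring_domain r s p -> N%:R * X ^+ 2 <=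
    \sum_(j < N) modulus (psum a L ((p.1 +i* p.2) * w ^+ j)) ^+ 2.
  move=> /andP[rp _].
  have h1 := modulus_coef_average a (p.1 +i* p.2) wN LN kL.
  have h2 := sum_sqr_le (fun j : 'I_N => modulus (psum a L ((p.1 +i* p.2) * w ^+ j))).
  have NX : N%:R * X <= \sum_(j < N) modulus (psum a L ((p.1 +i* p.2) * w ^+ j)).
    apply: le_trans h1; rewrite XE ler_wpM2l ?ler0n// ler_wpM2l ?modulus_ge0//.
    by rewrite lerXn2r ?nnegrE ?modulus_ge0.
  have : (N%:R * X) ^+ 2 <= N%:R * \sum_(j < N) modulus (psum a L ((p.1 +i* p.2) * w ^+ j)) ^+ 2.
    apply: le_trans h2; rewrite lerXn2r ?nnegrE//.
      by rewrite mulr_ge0// ler0n.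
    by apply: sumr_ge0 => j _; exact: modulus_ge0.
  by rewrite exprMn expr2 -mulrA ler_pM2l ?ltr0n.
have NE : (0 < N%:R%:E :> \bar R)%E by rewrite lte_fin ltr0n.
rewrite -(lee_pmul2l _ NE)//.
apply: (@le_trans _ _ (\int[mu2]_(p in ring_domain r s) (N%:R * X ^+ 2)%:E)%E).
  by rewrite integral_cst// muleA EFinM.
apply: (@le_trans _ _ (\int[mu2]_(p in ring_domain r s)
    \sum_(j < N) (modulus (psum a L ((p.1 +i* p.2) * w ^+ j)) ^+ 2)%:E)%E).
  apply: ge0_le_integral => //.
  - by move=> p _; rewrite lee_fin mulr_ge0 ?ler0n ?sqr_ge0.
  - by apply: emeasurable_sum => j; apply: measurable_funS (mP j).
  - by move=> p /point; rewrite sumEFin lee_fin.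
apply: (@le_trans _ _ (\int[mu2]_(p in disc s)
    \sum_(j < N) (modulus (psum a L ((p.1 +i* p.2) * w ^+ j)) ^+ 2)%:E)%E).
  apply: ge0_subset_integral => //.
  - by apply: emeasurable_sum => j; apply: measurable_funS (mP j).
  - by move=> p _; apply: sume_ge0 => j _; rewrite lee_fin sqr_ge0.
  - by move=> p /andP[].
rewrite ge0_integral_sum//; last 2 first.
  - by move=> j; apply: measurable_funS (mP j).
  - by move=> j p _; rewrite lee_fin sqr_ge0.
rewrite (eq_bigr (fun=> energy (disc s) (psum a L))).
  by rewrite sumr_const card_ord mule_natl.
move=> j _; rewrite -(@energy_rotation a L (w ^+ j) s)//.
by rewrite modulusX w1 expr1n.
Qed.

End Energy.

(** * The mean square bounds the coefficients *)

Section CoefficientBound.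
Context {R : realType}.
Local Notation mu := (@lebesgue_measure R).
Local Notation mu2 := (@lebesgue_measure R \x @lebesgue_measure R)%E.
Implicit Types (a b : nat -> R[i]) (f : R[i] -> R[i]).

Lemma area_rectangle (i j : interval R) :
  (mu2 ([set` i] `*` [set` j])%classic = mu [set` i] * mu [set` j])%E.
Proof. by apply: product_measure1E; exact: measurable_itv. Qed.

Lemma area_disc_lty (r : R) : r <= 1 -> (mu2 (disc r) < +oo)%E.
Proof.
move=> r1; apply: (@le_lt_trans _ _ (mu2 (`[(-1)%R, 1%R] `*` `[(-1)%R, 1%R])%classic)).
  apply: le_measure; rewrite ?inE; first exact: measurable_disc.
    by apply: measurableX; exact: measurable_itv.
  move=> [x y]; rewrite /disc /= !in_itv /= -!ler_norml => xy.
  have := norm_Re_le (x +i* y); have := norm_Im_le (x +i* y) => /= h1 h2.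
  by split; [apply: le_trans h2 _|apply: le_trans h1 _]; lra.
rewrite area_rectangle !lebesgue_measure_itv /=.
by rewrite lte_fin ifT ?ltry//; lra.
Qed.

Lemma area_ring_gt0 (r s : R) : 0 <= r -> r < s -> (0 < mu2 (ring_domain r s))%E.
Proof.
move=> r0 rs.
apply: (@lt_le_trans _ _ (mu2 (`]r, ((r + s) / 2)[ `*` `]0%R, ((s - r) / 2)[)%classic)).
  rewrite area_rectangle !lebesgue_measure_itv /= !lte_fin.
  rewrite !ifT; [|lra|lra].
  by rewrite -EFinM lte_fin mulr_gt0; lra.
apply: le_measure; rewrite ?inE.
- by apply: measurableX; exact: measurable_itv.
- exact: measurable_ring_domain.
move=> [x y] /= []; rewrite !in_itv /= => /andP[rx xr] /andP[y0 ys].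
have := norm_Re_le (x +i* y); have := modulus_le_ReIm (x +i* y) => /=.
rewrite /ring_domain /= (@ger0_norm _ x); last by lra.
by rewrite (@ger0_norm _ y) => [h1 h2|]; [apply/andP; split; lra|lra].
Qed.

Lemma psum_uniform a f (r e : R) : 0 <= r -> r < 1 -> 0 < e ->
  expands_at f 0 a 1 -> \forall n \near \oo,
  forall z, modulus z <= r -> modulus (psum a n z - f z) <= e.
Proof.
move=> r0 r1 e0 af.
have [s /andP[rs s1]] : exists s, r < s < 1.
  by exists ((r + 1) / 2); apply/andP; split; lra.
have s0 : 0 < s by lra.
have [M aM] : exists M, Cauchy_bound a s M.
  by apply: (@has_psum_bounded_lt _ a 1 (fun w => f (0 + w))) => //; exact: ltW.
have M0 := Cauchy_bound_ge0 aM.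
have q0 : 0 <= r / s by rewrite divr_ge0// ltW.
have q1 : r / s < 1 by rewrite ltr_pdivrMr// mul1r.
have /cvgr0Pnorm_lt /(_ _ e0) := tail_cvg0 M q0 q1.
apply: filterS => n hn z zr.
have zs : modulus z < s by exact: le_lt_trans rs.
have z1 : modulus z < 1 by lra.
have := af z z1; rewrite add0r => /(has_psum_tail n s0 zs aM).
rewrite modulusC => /le_trans; apply.
have zq : modulus z / s <= r / s by rewrite ler_pM2r ?invr_gt0.
have z0 : 0 <= modulus z / s by rewrite divr_ge0 ?modulus_ge0// ltW.
apply: le_trans (ltW (le_lt_trans (ler_norm _) hn)).
apply: ler_pM.
- by rewrite mulr_ge0 ?exprn_ge0.
- by rewrite invr_ge0 subr_ge0 (le_trans zq)// ltW.
- by rewrite ler_wpM2l// lerXn2r ?nnegrE.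
- by rewrite lef_pV2 ?posrE ?subr_gt0 ?(le_lt_trans zq)//; lra.
Qed.

(** The bound holds for the partial sums by averaging over rotations, and these are
    uniformly close to [f] on the disc of radius [s].  The factor [2] is the price
    of comparing the squares by [|P|^2 <= 2 |f|^2 + 2 e^2]. *)
Lemma energy_coef_bound (r : R) : 0 < r -> r < 1 -> exists2 K : R, 0 < K &
  forall f a (E : R), expands_at f 0 a 1 -> (energy (disc 1) f <= E%:E)%E ->
  forall k, (modulus (a k) * r ^+ k) ^+ 2 <= K * E.
Proof.
move=> r0 r1.
have [s /andP[rs s1]] : exists s, r < s < 1.
  by exists ((r + 1) / 2); apply/andP; split; lra.
have mD := measurable_disc s.
have A0 := area_ring_gt0 (ltW r0) rs.
have BE := area_disc_lty (ltW s1).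
have AB : (mu2 (ring_domain r s) <= mu2 (disc s))%E.
  apply: le_measure; rewrite ?inE//; first exact: measurable_ring_domain.
  by move=> p /andP[].
have [B Bdef] : exists B : R, mu2 (disc s) = B%:E.
  exists (fine (mu2 (disc s))); rewrite fineK// ge0_fin_numE//.
have [A Adef] : exists A : R, mu2 (ring_domain r s) = A%:E.
  exists (fine (mu2 (ring_domain r s))); rewrite fineK// ge0_fin_numE//.
  exact: le_lt_trans AB BE.
rewrite Adef lte_fin in A0.
exists (2 / A); first by rewrite divr_gt0.
move=> f a E af fE k.
have mf1 := measurable_expansion af.
have sub1 : disc s `<=` disc 1 by move=> p; rewrite /disc /= => h; apply: lt_trans s1.
have mf : measurable_fun (disc s) (fun p => modulus (f (p.1 +i* p.2)) ^+ 2).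
  by apply: measurable_funS mf1 => //; exact: measurable_disc.
rewrite mulrAC ler_pdivlMr//.
have key e : 0 < e -> (modulus (a k) * r ^+ k) ^+ 2 * A <= 2 * E + 2 * e ^+ 2 * B.
  move=> e0; have [n _ nP] := psum_uniform (le_trans (ltW r0) (ltW rs)) s1 e0 af.
  pose L := maxn n k.+1.
  have kL : (k < L)%N by exact: leq_maxr.
  have := energy_psum_coef a s kL (ltW r0); rewrite Adef -EFinM -lee_fin.
  move=> /le_trans; apply.
  apply: (@le_trans _ _ (\int[mu2]_(p in disc s)
     (2%:E * (modulus (f (p.1 +i* p.2)) ^+ 2)%:E + (2 * e ^+ 2)%:E))%E).
    apply: ge0_le_integral => //.
    - by move=> p _; rewrite lee_fin sqr_ge0.
    - apply/measurable_EFinP; apply: measurable_funS (measurable_modulus_sqr _) => //.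
      exact: complex_measurable_psum complex_measurable_id.
    - under eq_fun do rewrite -EFinM -EFinD; apply/measurable_EFinP.
      by apply: measurable_funD; [apply: measurable_funM|exact: measurable_cst].
    - move=> p ps; rewrite -EFinM -EFinD lee_fin.
      have := nP L (leq_maxl _ _) _ (ltW ps).
      have := modulus_distl (psum a L (p.1 +i* p.2)) (f (p.1 +i* p.2)).
      have := modulus_ge0 (psum a L (p.1 +i* p.2)).
      have := modulus_ge0 (f (p.1 +i* p.2)).
      move: (modulus (f _)) (modulus (psum _ _ _)) (modulus (_ - _)) => x y d.
      move=> x0 y0 yd de; have yx : y <= x + e by lra.
      apply: (@le_trans _ _ ((x + e) ^+ 2)).
        by rewrite lerXn2r ?nnegrE//; lra.
      by have := sqr_ge0 (x - e); nra.
  rewrite ge0_integralD//; last 3 first.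
  - by move=> p _; rewrite -EFinM lee_fin mulr_ge0 ?sqr_ge0.
  - under eq_fun do rewrite -EFinM; apply/measurable_EFinP.
    by apply: measurable_funM.
  - by move=> p _; rewrite lee_fin mulr_ge0 ?sqr_ge0.
  rewrite ge0_integralZl//; last 2 first.
  - exact/measurable_EFinP.
  - by move=> p _; rewrite lee_fin sqr_ge0.
  have -> : (\int[mu2]_(p in disc s) (2 * e ^+ 2)%:E = (2 * e ^+ 2 * B)%:E)%E.
    by rewrite (EFinM (2 * e ^+ 2)) -Bdef; exact: integral_cst.
  have hI : (energy (disc s) f <= E%:E)%E.
    by apply: le_trans fE; apply: energyS => //; exact: measurable_disc.
  move: hI; rewrite /energy; move: (integral _ _ _) => I hI.
  rewrite [leRHS]EFinD (EFinM 2 E).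
  by apply: leeD => //; apply: lee_wpmul2l => //; rewrite lee_fin.
apply/ler_addgt0Pr => e e0.
have B0 : 0 <= B by rewrite -lee_fin -Bdef.
pose d := Num.min 1 (e / (2 * B + 1)).
have d0 : 0 < d by rewrite lt_min ltr01 divr_gt0//; lra.
have d1 : d <= 1 by rewrite ge_min lexx.
have dB : d * (2 * B + 1) <= e.
  by rewrite -ler_pdivlMr ?ge_min ?lexx ?orbT//; lra.
apply: le_trans (key _ d0) _; rewrite mulrC lerD//; nra.
Qed.

Lemma energy_eq0 f a : expands_at f 0 a 1 -> (energy (disc 1) f <= 0)%E ->
  forall k, a k = 0.
Proof.
move=> af f0; have r0 : 0 < 2^-1 :> R by lra.
have r1 : 2^-1 < 1 :> R by lra.
have [K K0 KP] := energy_coef_bound r0 r1.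
apply: (Cauchy_bound0 r0) => k.
have := KP f a 0 af f0 k; rewrite mulr0 => h.
by have := sqr_ge0 (modulus (a k) * 2^-1 ^+ k); rewrite le0r ltNge h orbF sqrf_eq0 => /eqP ->.
Qed.

End CoefficientBound.

(** * Limits of bounded families of coefficients *)

Section Compactness.
Context {R : realType}.
Implicit Types (a b : nat -> R[i]) (z l : R[i]).

Lemma ultra_bounded_cvg (G : set_system nat) (u : nat -> R) (B : R) :
  UltraFilter G -> (forall n, `|u n| <= B) -> exists x : R, u n @[n --> G] --> x.
Proof.
move=> uG uB; have GP : ProperFilter (u n @[n --> G]).
  exact: fmap_proper_filter.
have uA : (u n @[n --> G]) `[- B, B]%classic.
  apply: (@filterS _ G _ setT) => [n _|]; last exact: filterT.
  by rewrite /= in_itv /= -ler_norml.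
have [x [_ xu]] := @segment_compact R (- B) B _ GP uA.
exists x => V /= Vx; have [//|nV] := in_ultra_setVsetC (u @^-1` V) uG.
by have [y [nVy Vy]] := xu (~` V) V nV Vx.
Qed.

(** Along an ultrafilter finer than the Frechet filter all the coordinates
    converge at once; only the limits are kept, and the indices that realise them
    on finitely many coordinates are found afterwards. *)
Lemma bounded_family_cluster (I : eqType) (c : nat -> I -> R[i]) (B : I -> R) :
  (forall n i, modulus (c n i) <= B i) ->
  exists l : I -> R[i], forall (s : seq I) (e : R) (m : nat), 0 < e ->
    exists n, (m <= n)%N /\ forall i, i \in s -> modulus (c n i - l i) < e.
Proof.
move=> cB; have [G [uG oG]] := ultraFilterLemma (@eventually_filter).
have /choice[x xP] : forall i, exists x : R, complex.Re (c n i) @[n --> G] --> x.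
  move=> i; apply: (ultra_bounded_cvg (B := B i)) => // n.
  exact: le_trans (norm_Re_le _) (cB n i).
have /choice[y yP] : forall i, exists y : R, complex.Im (c n i) @[n --> G] --> y.
  move=> i; apply: (ultra_bounded_cvg (B := B i)) => // n.
  exact: le_trans (norm_Im_le _) (cB n i).
exists (fun i => x i +i* y i) => s e m e0.
have e2 : 0 < e / 2 by rewrite divr_gt0.
have near_i i : G [set n | modulus (c n i - (x i +i* y i)) < e].
  have /cvgrPdist_lt/(_ _ e2) h1 := xP i; have /cvgrPdist_lt/(_ _ e2) h2 := yP i.
  apply: filterS (filterI h1 h2) => n [/= k1 k2].
  apply: le_lt_trans (modulus_le_ReIm _) _; move: k1 k2.
  by case: (c n i) => p q /=; rewrite distrC (distrC (y i)); lra.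
have all_s : G [set n | forall i, i \in s -> modulus (c n i - (x i +i* y i)) < e].
  elim: s => [|i s IH]; first by apply: (@filterS _ G _ setT) => //; exact: filterT.
  apply: filterS (filterI (near_i i) IH) => n [/= h1 h2] j.
  by rewrite inE => /predU1P[->|/h2].
have Gm : G [set n | (m <= n)%N] by apply: oG; exact: nbhs_infty_ge.
have [n [h1 h2]] := filter_ex (filterI Gm all_s).
by exists n.
Qed.

Lemma inv_succ_cvg0 : (m.+1%:R^-1 : R) @[m --> \oo] --> (0 : R).
Proof. exact: cvg_harmonic. Qed.

Lemma Cauchy_bound_limit (al : nat -> nat -> R[i]) a s K : 0 <= s -> s <= 1 ->
  (forall m, Cauchy_bound (al m) s K) ->
  (forall m k, (k < m)%N -> modulus (al m k - a k) <= m.+1%:R^-1) ->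
  Cauchy_bound a s K.
Proof.
move=> s0 s1 alK ala k; apply/ler_addgt0Pr => e e0.
have /cvgr0Pnorm_lt/(_ _ e0)[N _ hN] := inv_succ_cvg0.
have [m [Nm km]] : exists m, (N <= m)%N /\ (k < m)%N.
  by exists (maxn N k.+1); rewrite leq_maxl leq_maxr.
have := hN m Nm => /=; rewrite ger0_norm ?invr_ge0// => me.
have h1 := ala m k km; have h2 := alK m k.
have h3 := modulus_distl (a k) (al m k); rewrite modulusC in h3.
have sk0 : 0 <= s ^+ k by rewrite exprn_ge0.
have sk1 : s ^+ k <= 1 by rewrite exprn_ile1.
have : modulus (a k) * s ^+ k <= (modulus (al m k) + m.+1%:R^-1) * s ^+ k.
  by rewrite ler_wpM2r//; apply: le_trans h3 _; rewrite lerD2l.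
rewrite mulrDl.
have : m.+1%:R^-1 * s ^+ k <= m.+1%:R^-1 by rewrite ler_piMr// invr_ge0.
by move: me h2; move: (m.+1%:R^-1) => t; lra.
Qed.

Lemma Cauchy_bound_modulus a s K z l : 0 < s -> modulus z < s ->
  Cauchy_bound a s K -> has_psum a z l ->
  modulus l <= K / (1 - modulus z / s).
Proof.
move=> s0 zs aK al; have := has_psum_tail 0 s0 zs aK al.
by rewrite /psum big_ord0 subr0 expr0 mulr1.
Qed.

(** Dominated convergence for series: the common bound makes the tails after [m]
    terms small, and the first [m] coefficients are within [m.+1%:R^-1]. *)
Lemma has_psum_dominated (al : nat -> nat -> R[i]) a s K z (F : nat -> R[i]) l :
  modulus z < s -> s < 1 ->
  (forall m, Cauchy_bound (al m) s K) ->
  (forall m k, (k < m)%N -> modulus (al m k - a k) <= m.+1%:R^-1) ->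
  (forall m, has_psum (al m) z (F m)) -> has_psum a z l -> tends F l.
Proof.
move=> zs s1 alK ala alF az.
have z0 := modulus_ge0 z.
have s0 : 0 < s by apply: le_lt_trans zs.
have z1 : modulus z < 1 by apply: lt_trans s1.
have aK := Cauchy_bound_limit (ltW s0) (ltW s1) alK ala.
have q0 : 0 <= modulus z / s by rewrite divr_ge0// ltW.
have q1 : modulus z / s < 1 by rewrite ltr_pdivrMr// mul1r.
pose T m := K * (modulus z / s) ^+ m / (1 - modulus z / s).
apply: (@tends_squeeze _ _ _ (fun m => T m + T m + m.+1%:R^-1 * (1 - modulus z)^-1)).
  apply: nearW => m.
  have h1 := has_psum_tail m s0 zs (alK m) (alF m).
  have h2 := has_psum_tail m s0 zs aK az; rewrite modulusC in h2.
  have h3 : modulus (psum (al m) m z - psum a m z) <= m.+1%:R^-1 * (1 - modulus z)^-1.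
    rewrite /psum -sumrB; apply: le_trans (modulus_sum _ _ _) _.
    apply: (@le_trans _ _ (\sum_(k < m) m.+1%:R^-1 * modulus z ^+ k)).
      apply: ler_sum => k _; rewrite -mulrBl modulusM modulusX.
      by rewrite ler_wpM2r ?exprn_ge0// ala.
    by rewrite -mulr_sumr ler_wpM2l ?invr_ge0// geometric_partial_sum.
  have h4 := modulus_triangle (psum (al m) m z) (F m) l.
  have h5 := modulus_triangle (psum a m z) (psum (al m) m z) l.
  move: h1 h2 h3 h4 h5; rewrite /T; move: (m.+1%:R^-1 * _) => t.
  by lra.
have T0 : T m @[m --> \oo] --> (0 : R) by exact: tail_cvg0.
rewrite -[0](addr0 0); apply: cvgD; first by rewrite -[0](addr0 0); exact: cvgD.
rewrite -(mul0r (1 - modulus z)^-1); apply: cvgMl; exact: inv_succ_cvg0.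
Qed.

End Compactness.

(** * The supremum of the quotient as a pointwise inequality *)

Section Quotient.
Context {R : realType}.
Implicit Types (a b : nat -> R[i]) (f g : R[i] -> R[i]) (z w : R[i]).

(** Where [f] and [g] do not both vanish they represent their own quotient, with
    exponent [0]; where both vanish the inequality is trivial. *)
Lemma quotient_sup_pointwise (c t : R) f g z :
  analytic_on unit_disc f -> analytic_on unit_disc g ->
  (quotient_sup c f g <= t%:E)%E -> c <= modulus z < 1 ->
  modulus (f z) <= t * modulus (g z).
Proof.
move=> fan gan sup_t zc.
have [/eqP f0|fz] := boolP (f z == 0).
  have [/eqP g0|gz] := boolP (g z == 0).
    by rewrite f0 g0 modulus0 mulr0.
  have : ((modulus (f z / g z))%:E <= t%:E)%E.
    apply: le_trans sup_t; apply: ereal_sup_ubound; exists z; split=> //.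
    exists 0%N, f, g; split=> //; last by rewrite (negbTE gz).
      by move=> w _; rewrite expr0 !mul1r.
    by right.
  rewrite lee_fin modulusM modulusV ler_pdivrMr//.
  by rewrite lt_neqAle eq_sym modulus_eq0 gz modulus_ge0.
have : ((if (g z == 0)%R then +oo else (modulus (f z / g z))%:E) <= t%:E)%E.
  apply: le_trans sup_t; apply: ereal_sup_ubound; exists z; split=> //.
  exists 0%N, f, g; split=> //; last by left.
  by move=> w _; rewrite expr0 !mul1r.
case: ifPn => // gz.
rewrite lee_fin modulusM modulusV ler_pdivrMr//.
by rewrite lt_neqAle eq_sym modulus_eq0 gz modulus_ge0.
Qed.

Lemma analytic_lipschitz (U : set R[i]) f z : analytic_on U f -> U z ->
  exists d C, [/\ 0 < d, 0 <= C &
    forall w, modulus w <= d -> modulus (f (z + w) - f z) <= C * modulus w].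
Proof.
move=> /analytic_onP fan /fan [a [d [d0 af]]].
have d2 : 0 < d / 2 by rewrite divr_gt0.
have d2d : d / 2 < d by lra.
have [M aM] : exists M, Cauchy_bound a (d / 2) M.
  exact: (@has_psum_bounded_lt _ a d (fun w => f (z + w)) _ (ltW d2) d2d af).
exists (d / 2 / 2), (2 * M / (d / 2)); split; first by rewrite divr_gt0.
  by rewrite divr_ge0 ?mulr_ge0 ?(Cauchy_bound_ge0 aM)// ltW.
move=> w wd.
have fz : f z = a 0%N.
  have := af 0; rewrite modulus0 addr0 => /(_ d0) h.
  exact: tends_unique h (has_psum0 a).
rewrite fz; apply: (has_psum_lipschitz d2 wd aM); apply: af.
by apply: le_lt_trans wd _; lra.
Qed.

(** At a common zero the inequality survives the cancellation by continuity: the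
    point is approached radially from outside, so that the comparison with
    [f] and [g] stays inside the ring. *)
Lemma quotient_sup_le (c t : R) f g : 0 < c -> 0 <= t ->
  (forall z, c <= modulus z < 1 -> modulus (f z) <= t * modulus (g z)) ->
  (quotient_sup c f g <= t%:E)%E.
Proof.
move=> c0 t0 fg; apply: ge_ereal_sup => v [z [/andP[cz z1]]].
move=> [m [f1 [g1 [[f1an g1an] fgE f1g1 ->]]]].
have z0 : 0 < modulus z by lra.
suff key : modulus (f1 z) <= t * modulus (g1 z).
  have [/eqP g0|gz] := ifPn.
    exfalso; move: key; rewrite g0 modulus0 mulr0 => f0.
    have : f1 z == 0 by rewrite -modulus_eq0 eq_le f0 modulus_ge0.
    by case: f1g1; rewrite ?g0 ?eqxx// => /negbTE ->.
  rewrite lee_fin modulusM modulusV ler_pdivrMr//.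
  by rewrite lt_neqAle eq_sym modulus_eq0 gz modulus_ge0.
have [d [C [d0 C0 fC]]] := analytic_lipschitz f1an z1.
have [d' [C' [d'0 C'0 gC]]] := analytic_lipschitz g1an z1.
apply/ler_addgt0Pr => e e0.
have [h [h0 hd hd' h1 he]] : exists h, [/\ 0 < h, h <= d, h <= d',
    h < 1 - modulus z & (C + t * C') * h <= e].
  have D0 : 0 <= C + t * C' by rewrite addr_ge0// mulr_ge0.
  pose h := Num.min (Num.min d d') (Num.min ((1 - modulus z) / 2) (e / (C + t * C' + 1))).
  exists h; split.
  - by rewrite !lt_min d0 d'0 !divr_gt0 ?subr_gt0//; lra.
  - by rewrite !ge_min lexx.
  - by rewrite !ge_min lexx orbT.
  - apply: (@le_lt_trans _ _ ((1 - modulus z) / 2)); last by lra.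
    by rewrite !ge_min lexx !orbT.
  - apply: (@le_trans _ _ ((C + t * C' + 1) * h)).
      rewrite ler_wpM2r//; last by lra.
      by rewrite !le_min (ltW d0) (ltW d'0) !divr_ge0 ?subr_ge0 ?ltW//; lra.
    rewrite mulrC -ler_pdivlMr; last by lra.
    by rewrite !ge_min lexx !orbT.
pose w := z * (h / modulus z)%:C.
have wh : modulus w = h.
  rewrite /w modulusM modulus_real ger0_norm ?divr_ge0 ?ltW//.
  by rewrite mulrC divfK ?gt_eqF.
have zw : modulus (z + w) = modulus z + h.
  have -> : z + w = z * (1 + h / modulus z)%:C.
    by rewrite /w rmorphD /= rmorph1 mulrDr mulr1.
  rewrite modulusM modulus_real ger0_norm; first by field; rewrite gt_eqF.
  by rewrite addr_ge0// divr_ge0 ?ltW.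
have zw1 : modulus (z + w) < 1 by rewrite zw; lra.
have near_le : modulus (f1 (z + w)) <= t * modulus (g1 (z + w)).
  have := fg (z + w); rewrite zw1 andbT zw => H.
  have /H : c <= modulus z + h by lra.
  have [-> ->] := fgE _ zw1.
  rewrite !modulusM modulusX addrAC subrr add0r wh mulrCA ler_pM2l//.
  by rewrite exprn_gt0.
have := fC w; rewrite wh => /(_ hd) h2; have := gC w; rewrite wh => /(_ hd') h3.
have h4 := modulus_distl (f1 z) (f1 (z + w)); rewrite modulusC in h4.
have h5 := modulus_distl (g1 (z + w)) (g1 z).
have : t * modulus (g1 (z + w)) <= t * (modulus (g1 z) + C' * h).
  by rewrite ler_wpM2l//; lra.
move: h2 h4 near_le he; rewrite mulrDr mulrDl mulrA; lra.
Qed.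

Lemma expansion_vanishing (c : R) f a : 0 < c -> c < 1 -> expands_at f 0 a 1 ->
  (forall z, c <= modulus z < 1 -> f z = 0) -> forall k, a k = 0.
Proof.
move=> c0 c1 af f0.
have [r /andP[cr r1]] : exists r, c < r < 1.
  by exists ((c + 1) / 2); apply/andP; split; lra.
have r0 : 0 <= r by lra.
have [B aB] := @has_psum_bounded_lt _ a 1 (fun w => f (0 + w)) r r0 r1 af.
apply: (Cauchy_bound0 c0); apply: (Cauchy_estimate c0 cr aB) => z l zc al.
have z1 : modulus z < 1 by rewrite zc.
have := af z z1; rewrite add0r f0 ?zc ?lexx// => /(tends_unique al) ->.
by rewrite modulus0.
Qed.

Lemma expansion_eq0 f a z : expands_at f 0 a 1 -> (forall k, a k = 0) ->
  modulus z < 1 -> f z = 0.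
Proof.
move=> af a0 /af; rewrite add0r => h; apply: tends_unique h _.
rewrite (_ : (fun n => psum a n z) = fun=> 0); first exact: tends_cst.
by apply/funext => n; rewrite /psum big1// => k _; rewrite a0 mul0r.
Qed.

Lemma expandsZ (x : R[i]) f a : expands_at f 0 a 1 ->
  expands_at (fun z => x * f z) 0 (fun k => x * a k) 1.
Proof. by move=> af w w1; apply: has_psumZ; exact: af. Qed.

Lemma expands_cst (x : R[i]) :
  expands_at (fun=> x) 0 (fun k => if k == 0%N then x else 0) 1.
Proof.
move=> w _; apply: (near_eq_tends _ (tends_cst x)).
exists 1%N => // -[//|n] _; rewrite /psum big_ord_recl expr0 mulr1 big1 ?addr0//.
by move=> k _ /=; rewrite mul0r.
Qed.

End Quotient.

(** * Bergman norm and normalization *)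

Section Norm.
Context {R : realType}.
Local Notation mu2 := (@lebesgue_measure R \x @lebesgue_measure R)%E.
Implicit Types (a b : nat -> R[i]) (f g : R[i] -> R[i]).

Lemma bergman_norm_eq1 f :
  bergman_norm f = 1%E <-> energy (disc 1) f = (pi : R)%:E.
Proof.
have E0 := energy_ge0 (disc (1 : R)) f.
have p0 := pi_gt0 R.
rewrite /bergman_norm -/(energy (disc 1) f) poweR12_sqrt; last first.
  by rewrite mule_ge0// lee_fin invr_ge0 ltW.
move: E0; case: (energy _ _) => [x x0||//]; last first.
  by rewrite gt0_muley ?lte_fin ?invr_gt0.
rewrite lee_fin in x0; rewrite -EFinM /=; split=> [[h]|[->]].
  have : (Num.sqrt (pi^-1 * x)) ^+ 2 = 1 by rewrite h expr1n.
  rewrite sqr_sqrtr; last by rewrite mulr_ge0// invr_ge0 ltW.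
  by move=> h2; congr EFin; rewrite -[RHS]mulr1 -h2 mulrA divff ?mul1r// gt_eqF.
by rewrite mulVf ?gt_eqF// sqrtr1.
Qed.

Lemma bergman_sphereP f : bergman_sphere f <->
  analytic_on unit_disc f /\ energy (disc 1) f = (pi : R)%:E.
Proof.
split=> [[[fan _] /bergman_norm_eq1 fE]//|[fan /bergman_norm_eq1 f1]].
by split=> //; split=> //; rewrite f1 ltry.
Qed.

Lemma energyZ (x : R[i]) f a : expands_at f 0 a 1 ->
  energy (disc 1) (fun z => x * f z) =
  ((modulus x ^+ 2)%:E * energy (disc 1) f)%E.
Proof.
move=> af; rewrite /energy -ge0_integralZl//.
- by apply: eq_integral => p _; rewrite modulusM exprMn EFinM.
- exact: measurable_disc.
- by apply/measurable_EFinP; exact: measurable_expansion af.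
- by move=> p _; rewrite lee_fin sqr_ge0.
by rewrite lee_fin sqr_ge0.
Qed.

Lemma normalized_sphere f a (X : R) : expands_at f 0 a 1 -> 0 < X ->
  energy (disc 1) f = X%:E ->
  bergman_sphere (fun z => (Num.sqrt (pi / X))%:C * f z).
Proof.
move=> af X0 fE; apply/bergman_sphereP; split.
  exact: expansion_analytic (expandsZ _ af).
rewrite (energyZ _ af) fE modulus_real ger0_norm ?sqrtr_ge0//.
rewrite sqr_sqrtr; last by rewrite divr_ge0 ?ltW ?pi_gt0.
by rewrite -EFinM divfK ?gt_eqF.
Qed.

End Norm.

(** * Mean squares of limits *)

Section EnergyLimit.
Context {R : realType}.
Local Notation mu2 := (@lebesgue_measure R \x @lebesgue_measure R)%E.
Implicit Types (a b : nat -> R[i]) (f g : R[i] -> R[i]).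

Lemma tends_modulus_sqr (u : nat -> R[i]) l : tends u l ->
  modulus (u n) ^+ 2 @[n --> \oo] --> (modulus l ^+ 2 : R).
Proof.
by move=> /tends_modulus h; rewrite expr2; under eq_fun do rewrite expr2; exact: cvgM.
Qed.

Lemma subset_disc (r s : R) : r <= s -> disc r `<=` disc s.
Proof. by move=> rs p; rewrite /disc /= => /lt_le_trans; apply. Qed.

Lemma subset_ring_disc (r s : R) : ring_domain r s `<=` disc s.
Proof. by move=> p /andP[]. Qed.

Lemma measurable_expansionS f a (D : set (R * R)) : expands_at f 0 a 1 ->
  D `<=` disc 1 ->
  measurable_fun D (fun p => modulus (f (p.1 +i* p.2)) ^+ 2).
Proof.
move=> af D1; apply: measurable_funS (measurable_expansion af) => //.
exact: measurable_disc.
Qed.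

Lemma energy_split (c : R) f a : c <= 1 -> expands_at f 0 a 1 ->
  energy (disc 1) f = (energy (disc c) f + energy (ring_domain c 1) f)%E.
Proof.
move=> c1 af; have DE : disc 1 = disc c `|` ring_domain c 1.
  rewrite ring_domainE setDUK//; exact: subset_disc.
rewrite /energy {1}DE ge0_integral_setU//.
- exact: measurable_disc.
- exact: measurable_ring_domain.
- by rewrite -DE; apply/measurable_EFinP; exact: measurable_expansion af.
- by move=> p _; rewrite lee_fin sqr_ge0.
- rewrite ring_domainE; apply/disj_setPS => p [h1 [_ h2]]; exact: h2.
Qed.

Lemma fatou_energy (fn : nat -> R[i] -> R[i]) (an : nat -> nat -> R[i]) f (E : R) :
  (forall n, expands_at (fn n) 0 (an n) 1) ->
  (forall z, modulus z < 1 -> tends (fun n => fn n z) (f z)) ->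
  (forall n, energy (disc 1) (fn n) = E%:E) ->
  (energy (disc 1) f <= E%:E)%E.
Proof.
move=> anf fnf fnE.
pose h n (p : R * R) := (modulus (fn n (p.1 +i* p.2)) ^+ 2)%:E.
have mD := measurable_disc (1 : R).
have mh n : measurable_fun (disc 1) (h n).
  by apply/measurable_EFinP; exact: measurable_expansion (anf n).
have h0 n p : disc 1 p -> (0 <= h n p)%E by move=> _; rewrite lee_fin sqr_ge0.
have := fatou mu2 mD mh h0.
rewrite (_ : integral _ _ _ = energy (disc 1) f); last first.
  apply: eq_integral => p; rewrite inE => p1.
  have cv : h n p @[n --> \oo] --> (modulus (f (p.1 +i* p.2)) ^+ 2)%:E.
    apply/fine_cvgP; split; first exact: nearW.
    exact: tends_modulus_sqr (fnf _ p1).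
  by have [] := cvg_limn_einf_sup cv.
move=> /le_trans; apply.
rewrite (_ : (fun n => _) = fun=> E%:E); last by apply/funext => n; exact: fnE.
by have [->] := cvg_limn_einf_sup (@cvg_cst _ E%:E _ \oo _).
Qed.

(** On a smaller disc the functions are uniformly bounded, so dominated convergence
    applies: mass can be lost at the boundary of the unit disc only. *)
Lemma energy_disc_cvg (c M : R) (fn : nat -> R[i] -> R[i])
    (an : nat -> nat -> R[i]) f a : c < 1 ->
  (forall n, expands_at (fn n) 0 (an n) 1) -> expands_at f 0 a 1 ->
  (forall z, modulus z < 1 -> tends (fun n => fn n z) (f z)) ->
  (forall n z, modulus z < c -> modulus (fn n z) <= M) ->
  (energy (disc c) (fn n) @[n --> \oo] --> energy (disc c) f)%E.
Proof.
move=> c1 anf af fnf fnM.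
have mD := measurable_disc c.
have Dc1 := subset_disc (ltW c1).
pose h n (p : R * R) := (modulus (fn n (p.1 +i* p.2)) ^+ 2)%:E.
have [] // := @dominated_convergence _ _ _ mu2 (disc c) mD h
  (fun p => (modulus (f (p.1 +i* p.2)) ^+ 2)%:E) (cst (M ^+ 2)%:E).
- by move=> n; apply/measurable_EFinP; exact: measurable_expansionS (anf n) _.
- by apply/measurable_EFinP; exact: measurable_expansionS af _.
- apply: aeW => p pc; apply/fine_cvgP; split; first exact: nearW.
  exact: tends_modulus_sqr (fnf _ (Dc1 _ pc)).
- apply/integrableP; split; first exact: measurable_cst.
  rewrite integral_cst// lte_mul_pinfty ?abse_ge0 ?abse_fin_num//.
  exact: area_disc_lty (ltW c1).
- apply: aeW => p n pc; rewrite /h /= lee_fin ger0_norm ?sqr_ge0//.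
  have := fnM n _ pc; have := modulus_ge0 (fn n (p.1 +i* p.2)) => k1 k2.
  by rewrite lerXn2r ?nnegrE//; apply: le_trans k2.
Qed.

Lemma energy_disc_lty (c : R) f a : c < 1 -> expands_at f 0 a 1 ->
  (energy (disc c) f < +oo)%E.
Proof.
move=> c1 af; have [c0|c0] := leP c 0.
  rewrite (_ : disc c = set0) ?/energy ?integral_set0 ?ltry//.
  apply/seteqP; split=> // p; rewrite /disc /= => pc.
  by have := lt_le_trans pc c0; rewrite ltNge modulus_ge0.
have [s /andP[cs s1]] : exists s, c < s < 1.
  by exists ((c + 1) / 2); apply/andP; split; lra.
have s0 : 0 < s by lra.
have [M aM] := @has_psum_bounded_lt _ a 1 (fun w => f (0 + w)) s (ltW s0) s1 af.
have M0 := Cauchy_bound_ge0 aM.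
have mD := measurable_disc c.
have Dc1 := subset_disc (ltW c1).
have cs1 : c / s < 1 by rewrite ltr_pdivrMr// mul1r.
pose B := M / (1 - c / s).
apply: (@le_lt_trans _ _ (\int[mu2]_(p in disc c) (B ^+ 2)%:E)%E).
  apply: ge0_le_integral => //.
  - by move=> p _; rewrite lee_fin sqr_ge0.
  - by apply/measurable_EFinP; exact: measurable_expansionS af Dc1.
  - move=> p pc; rewrite lee_fin.
    have ps : modulus (p.1 +i* p.2) < s by exact: lt_trans cs.
    have := af _ (Dc1 _ pc); rewrite add0r => /(Cauchy_bound_modulus s0 ps aM) h.
    have hB : modulus (f (p.1 +i* p.2)) <= B.
      apply: le_trans h _; rewrite ler_wpM2l// lef_pV2 ?posrE ?subr_gt0//.
        by rewrite lerD2l lerN2 ler_pM2r ?invr_gt0// ltW.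
      by apply: lt_trans cs1; rewrite ltr_pM2r ?invr_gt0.
    by rewrite lerXn2r ?nnegrE ?modulus_ge0//; apply: le_trans hB; exact: modulus_ge0.
rewrite integral_cst// lte_mul_pinfty ?lee_fin ?sqr_ge0//.
exact: area_disc_lty (ltW c1).
Qed.

(** The excess [|gn|^2 - |fn|^2] is nonnegative on the ring, so Fatou's lemma
    applies to it there, while nothing is lost on the inner disc: at least as much
    mass escapes to the boundary from [gn] as from [fn]. *)
Lemma energy_limit (c s M E : R) (fn gn : nat -> R[i] -> R[i])
    (an bn : nat -> nat -> R[i]) f g a b :
  c < 1 -> 0 <= s -> s <= 1 ->
  (forall n, expands_at (fn n) 0 (an n) 1) ->
  (forall n, expands_at (gn n) 0 (bn n) 1) ->
  expands_at f 0 a 1 -> expands_at g 0 b 1 ->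
  (forall z, modulus z < 1 -> tends (fun n => fn n z) (f z)) ->
  (forall z, modulus z < 1 -> tends (fun n => gn n z) (g z)) ->
  (forall n z, modulus z < c -> modulus (fn n z) <= M) ->
  (forall n z, modulus z < c -> modulus (gn n z) <= M) ->
  (forall n, energy (disc 1) (fn n) = E%:E) ->
  (forall n, energy (disc 1) (gn n) = E%:E) ->
  (forall n z, c <= modulus z < 1 -> modulus (fn n z) <= s * modulus (gn n z)) ->
  (energy (disc 1) g <= energy (disc 1) f)%E /\
  (((1 - s ^+ 2) * E)%:E <= energy (disc c) f)%E.
Proof.
move=> c1 s0 s1 anf bng af bg fnf gng fnM gnM fnE gnE fgn.
have c1' := ltW c1.
have fcv := energy_disc_cvg c1 anf af fnf fnM.
have gcv := energy_disc_cvg c1 bng bg gng gnM.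
have mR := measurable_ring_domain c (1 : R).
have R1 := @subset_ring_disc c 1.
have sq0 h (p : R * R) : (0 <= (modulus (h (p.1 +i* p.2) : R[i]) ^+ 2)%:E)%E.
  by rewrite lee_fin sqr_ge0.
have split_real h x : expands_at h 0 x 1 -> energy (disc 1) h = E%:E ->
    exists u v : R, [/\ energy (disc c) h = u%:E, energy (ring_domain c 1) h = v%:E,
      0 <= v & u + v = E].
  move=> hx hE; have := energy_split c1' hx; rewrite hE.
  have := energy_ge0 (disc c) h; have := energy_ge0 (ring_domain c 1) h.
  case: (energy _ _) => [v||] //; case: (energy _ _) => [u||] // v0 u0 [uv].
  by exists u, v; split.
have /choice[F1 /choice[F2 FP]] : forall n, exists u, exists v : R,
    [/\ energy (disc c) (fn n) = u%:E, energy (ring_domain c 1) (fn n) = v%:E,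
      0 <= v & u + v = E] by move=> n; exact: split_real (anf n) (fnE n).
have /choice[G1 /choice[G2 GP]] : forall n, exists u, exists v : R,
    [/\ energy (disc c) (gn n) = u%:E, energy (ring_domain c 1) (gn n) = v%:E,
      0 <= v & u + v = E] by move=> n; exact: split_real (bng n) (gnE n).
have ef n : energy (disc c) (fn n) = (F1 n)%:E by have [] := FP n.
have eg n : energy (disc c) (gn n) = (G1 n)%:E by have [] := GP n.
have fle n p : ring_domain c 1 p ->
    modulus (fn n (p.1 +i* p.2)) ^+ 2 <= s ^+ 2 * modulus (gn n (p.1 +i* p.2)) ^+ 2.
  move=> /(fgn n) h; rewrite -exprMn lerXn2r ?nnegrE ?modulus_ge0//.
  by rewrite mulr_ge0 ?modulus_ge0.
have sle (x : R) : 0 <= x -> s ^+ 2 * x <= x.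
  by move=> x0; rewrite ler_piMl// exprn_ile1.
have mfn n : measurable_fun (ring_domain c 1)
    (fun p => modulus (fn n (p.1 +i* p.2)) ^+ 2).
  exact: measurable_expansionS (anf n) R1.
have mgn n : measurable_fun (ring_domain c 1)
    (fun p => modulus (gn n (p.1 +i* p.2)) ^+ 2).
  exact: measurable_expansionS (bng n) R1.
have mfl : measurable_fun (ring_domain c 1)
    (fun p => modulus (f (p.1 +i* p.2)) ^+ 2).
  exact: measurable_expansionS af R1.
have mgl : measurable_fun (ring_domain c 1)
    (fun p => modulus (g (p.1 +i* p.2)) ^+ 2).
  exact: measurable_expansionS bg R1.
split.
  pose h n (p : R * R) := (modulus (gn n (p.1 +i* p.2)) ^+ 2 -
    modulus (fn n (p.1 +i* p.2)) ^+ 2)%:E.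
  pose hl (p : R * R) := (modulus (g (p.1 +i* p.2)) ^+ 2 -
    modulus (f (p.1 +i* p.2)) ^+ 2)%:E.
  have mh n : measurable_fun (ring_domain c 1) (h n).
    by apply/measurable_EFinP; exact: measurable_funB.
  have mhl : measurable_fun (ring_domain c 1) hl.
    by apply/measurable_EFinP; exact: measurable_funB.
  have h0 n p : ring_domain c 1 p -> (0 <= h n p)%E.
    move=> pr; rewrite lee_fin subr_ge0; apply: le_trans (fle n p pr) _.
    exact: sle (sqr_ge0 _).
  have hcv p : ring_domain c 1 p -> h n p @[n --> \oo] --> hl p.
    move=> /R1 p1; apply/fine_cvgP; split; first exact: nearW.
    by apply: cvgB; [exact: tends_modulus_sqr (gng _ p1)
                    |exact: tends_modulus_sqr (fnf _ p1)].
  have hl0 p : ring_domain c 1 p -> (0 <= hl p)%E.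
    move=> pr; apply: cvge_ge (hcv p pr); apply: nearW => n; exact: h0.
  have hE n : (\int[mu2]_(p in ring_domain c 1) h n p = (F1 n - G1 n)%:E)%E.
    have [_ fE2 _ FE] := FP n; have [_ gE2 _ GE] := GP n.
    have : (\int[mu2]_(p in ring_domain c 1) h n p +
        energy (ring_domain c 1) (fn n) = energy (ring_domain c 1) (gn n))%E.
      rewrite /energy -ge0_integralD//.
      - by apply: eq_integral => p _; rewrite /h -EFinD subrK.
      - exact: h0.
      - exact: mh.
      - by apply/measurable_EFinP; exact: mfn.
    rewrite fE2 gE2; case: (integral _ _ _) => [x||] // [xE].
    by congr EFin; lra.
  have := fatou mu2 mR mh h0.
  rewrite (_ : integral _ _ _ = (\int[mu2]_(p in ring_domain c 1) hl p)%E); last first.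
    apply: eq_integral => p; rewrite inE => pr.
    by have [] := cvg_limn_einf_sup (hcv p pr).
  rewrite (_ : (fun n => _) = (fun n => energy (disc c) (fn n) - energy (disc c) (gn n))%E);
    last by apply/funext => n; rewrite hE ef eg.
  have [fc gc] : energy (disc c) f \is a fin_num /\ energy (disc c) g \is a fin_num.
    by split; rewrite ge0_fin_numE ?energy_ge0//; [
      exact: energy_disc_lty af|exact: energy_disc_lty bg].
  have fgdef : (energy (disc c) f +? - energy (disc c) g)%E.
    by apply: fin_num_adde_defl; rewrite fin_numN.
  have [-> _ hle] := cvg_limn_einf_sup (cvgeB fgdef fcv gcv).
  rewrite (energy_split c1' af) (energy_split c1' bg).
  have -> : energy (ring_domain c 1) g =
      (\int[mu2]_(p in ring_domain c 1) hl p + energy (ring_domain c 1) f)%E.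
    rewrite /energy -ge0_integralD//.
      by apply: eq_integral => p _; rewrite /hl -EFinD subrK.
    by apply/measurable_EFinP; exact: mfl.
  rewrite addeA; apply: leeD => //.
  by rewrite addeC -leeBrDr.
(* The ring carries at most the fraction [s ^+ 2] of the energy of [fn n]. *)
have key n : (1 - s ^+ 2) * E <= F1 n.
  have [_ fE2 _ FE] := FP n; have [_ gE2 g20 GE] := GP n.
  have G10 : 0 <= G1 n by rewrite -lee_fin -eg energy_ge0.
  suff : F2 n <= s ^+ 2 * G2 n.
    have : s ^+ 2 * G2 n <= s ^+ 2 * E by rewrite ler_wpM2l ?sqr_ge0//; lra.
    lra.
  rewrite -lee_fin -fE2 EFinM -gE2 /energy -ge0_integralZl//; last 2 first.
  - by apply/measurable_EFinP; exact: mgn.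
  - by rewrite lee_fin sqr_ge0.
  apply: ge0_le_integral => //.
  - by apply/measurable_EFinP; exact: mfn.
  - by apply: emeasurable_funM; [exact: measurable_cst|apply/measurable_EFinP; exact: mgn].
  - by move=> p pr; rewrite -EFinM lee_fin; exact: fle.
by apply: cvge_ge fcv; apply: nearW => n; rewrite ef lee_fin.
Qed.

End EnergyLimit.

(** * Compactness of the unit sphere and extremal pairs *)

Section Extremal.
Context {R : realType}.
Implicit Types (a b : nat -> R[i]) (f g : R[i] -> R[i]).

Lemma energy_pi_neq0 f a : expands_at f 0 a 1 -> energy (disc 1) f = (pi : R)%:E ->
  ~ (forall k, a k = 0).
Proof.
move=> af fE a0; have : (energy (disc 1) f <= 0)%E.
  rewrite /energy integral0_eq// => p p1.
  by rewrite (expansion_eq0 af a0 p1) modulus0 expr0n.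
by rewrite fE lee_fin leNgt pi_gt0.
Qed.

Lemma extremal_value_approx (c t : R) : (extremal_value c < t%:E)%E ->
  exists f g, [/\ bergman_sphere f, bergman_sphere g &
    forall z : R[i], c <= modulus z < 1 -> modulus (f z) <= t * modulus (g z)].
Proof.
move=> /ereal_inf_lt [s [f [g [fS gS ->]]] /ltW st].
exists f, g; split=> // z; apply: quotient_sup_pointwise st.
  by have [] := (bergman_sphereP f).1 fS.
by have [] := (bergman_sphereP g).1 gS.
Qed.

(** A negative value would give a pair with [|f| <= 0] on the ring, and then [f]
    would vanish. *)
Lemma extremal_value_ge0 (c : R) : 0 < c -> c < 1 ->
  (0 <= extremal_value c)%E.
Proof.
move=> c0 c1; rewrite leNgt; apply/negP => /extremal_value_approx.
move=> [f [g [/bergman_sphereP[fan fE] _ fg]]].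
have [a af] := analytic_expansion fan.
apply: (energy_pi_neq0 af fE); apply: (expansion_vanishing c0 c1 af) => z zc.
apply/eqP; rewrite -modulus_eq0 eq_le modulus_ge0 andbT.
by have := fg z zc; rewrite mul0r.
Qed.

Lemma energy_cst1_pos : exists2 X : R, 0 < X & energy (disc 1) (fun=> 1) = X%:E.
Proof.
have af := @expands_cst R 1.
have E1 : (energy (disc (1 : R)) (fun=> 1%R) < +oo)%E.
  rewrite /energy; under eq_integral do rewrite modulus1 expr1n.
  by rewrite integral_cst ?mul1e; [exact: area_disc_lty|exact: measurable_disc].
have E0 := energy_ge0 (disc (1 : R)) (fun=> 1).
move: E0 E1 (energy_eq0 af); case: (energy _ _) => [X||] //.
rewrite lee_fin => X0 _ H; exists X => //.
rewrite lt_neqAle X0 andbT; apply/eqP => X0'.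
have := H _ 0%N; rewrite /= -X0' => /(_ (lexx _)) /eqP.
by rewrite oner_eq0.
Qed.

(** Functions of the unit sphere have energy [pi], so one constant serves for all. *)
Lemma bergman_sphere_bounded (r : R) : 0 < r -> r < 1 -> exists K : R,
  forall f a, expands_at f 0 a 1 -> energy (disc 1) f = (pi : R)%:E ->
  Cauchy_bound a r K.
Proof.
move=> r0 r1; have [K K0 KP] := energy_coef_bound r0 r1.
exists (1 + K * pi) => f a af fE k.
have := KP f a pi af _ k; rewrite fE => /(_ (lexx _)) h.
have : 0 <= modulus (a k) * r ^+ k by rewrite mulr_ge0 ?modulus_ge0 ?exprn_ge0 ?ltW.
by move: (modulus _ * _) h => x h x0; have := sqr_ge0 (x - 1); nra.
Qed.

(** Montel's theorem for the unit sphere, along the same indices for both sequences.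
    The index map [sg] dominates the identity, so a limit along [n] is also the
    limit along [sg]. *)
Lemma bergman_sphere_compact (fn gn : nat -> R[i] -> R[i])
    (an bn : nat -> nat -> R[i]) :
  (forall n, expands_at (fn n) 0 (an n) 1) ->
  (forall n, expands_at (gn n) 0 (bn n) 1) ->
  (forall n, energy (disc 1) (fn n) = (pi : R)%:E) ->
  (forall n, energy (disc 1) (gn n) = (pi : R)%:E) ->
  exists (sg : nat -> nat) f g a b, [/\ forall m, (m <= sg m)%N,
    expands_at f 0 a 1, expands_at g 0 b 1,
    forall z, modulus z < 1 -> tends (fun m => fn (sg m) z) (f z) &
    forall z, modulus z < 1 -> tends (fun m => gn (sg m) z) (g z)].
Proof.
move=> anf bng fnE gnE.
pose cf (n : nat) (i : bool * nat) := if i.1 then an n i.2 else bn n i.2.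
have h0 : 0 < 2^-1 :> R by lra.
have h1 : 2^-1 < 1 :> R by lra.
have [K KP] := bergman_sphere_bounded h0 h1.
have cfB n i : modulus (cf n i) <= K / 2^-1 ^+ i.2.
  rewrite ler_pdivlMr ?exprn_gt0//; case: i => -[] k; rewrite /cf /=.
    exact: KP (anf n) (fnE n) k.
  exact: KP (bng n) (gnE n) k.
have [l lP] := bounded_family_cluster cfB.
have /choice[sg sgP] : forall m, exists n, (m <= n)%N /\
    forall k, (k < m)%N -> modulus (an n k - l (true, k)) <= m.+1%:R^-1 /\
      modulus (bn n k - l (false, k)) <= m.+1%:R^-1.
  move=> m; have e0 : 0 < m.+1%:R^-1 :> R by rewrite invr_gt0.
  have [n [mn nP]] := lP [seq (i, k) | i <- [:: true; false], k <- iota 0 m] _ m e0.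
  exists n; split=> // k km; split; apply: ltW; [apply: (nP (true, k))|apply: (nP (false, k))];
    by apply: allpairs_f; rewrite ?inE // mem_iota.
pose a k := l (true, k); pose b k := l (false, k).
have lim (x : nat -> nat -> R[i]) (y : nat -> R[i]) (F : nat -> R[i] -> R[i]) :
    (forall n, expands_at (F n) 0 (x n) 1) ->
    (forall n, energy (disc 1) (F n) = (pi : R)%:E) ->
    (forall m k, (k < m)%N -> modulus (x (sg m) k - y k) <= m.+1%:R^-1) ->
    exists G : R[i] -> R[i], expands_at G 0 y 1 /\
      forall z, modulus z < 1 -> tends (fun m => F (sg m) z) (G z).
  move=> xF FE xy.
  have bnd r : 0 < r -> r < 1 -> exists K : R, forall m, Cauchy_bound (x (sg m)) r K.
    move=> r0 r1; have [K' K'P] := bergman_sphere_bounded r0 r1.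
    by exists K' => m; exact: K'P (xF _) (FE _).
  have mid z : modulus z < 1 -> exists r : R, [/\ 0 < r, modulus z < r & r < 1].
    by move=> z1; exists ((modulus z + 1) / 2); have := modulus_ge0 z; split; lra.
  have /choice[G GP] : forall z, exists v, modulus z < 1 -> has_psum y z v.
    move=> z; have [z1|z1] := ltP (modulus z) 1; last by exists 0.
    have [r [r0 zr r1]] := mid z z1; have [K' K'P] := bnd r r0 r1.
    have yK := Cauchy_bound_limit (ltW r0) (ltW r1) K'P xy.
    by have [v yv] := has_psum_exists r0 zr yK; exists v.
  exists G; split; first by move=> w w1; rewrite add0r; exact: GP.
  move=> z z1; have [r [r0 zr r1]] := mid z z1; have [K' K'P] := bnd r r0 r1.
  apply: (has_psum_dominated zr r1 K'P xy) (GP z z1) => m.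
  by have := xF (sg m) _ z1; rewrite add0r.
have [f [af ft]] := lim an a fn anf fnE (fun m k km => ((sgP m).2 k km).1).
have [g [bg gt]] := lim bn b gn bng gnE (fun m k km => ((sgP m).2 k km).2).
by exists sg, f, g, a, b; split=> // m; exact: (sgP m).1.
Qed.

(** A function of the unit sphere paired with itself has quotient supremum at
    most [1]. *)
Lemma extremal_pair_of_ge1 (c : R) : 0 < c -> (1 <= extremal_value c)%E ->
  exists f g : R[i] -> R[i], [/\ bergman_sphere f, bergman_sphere g &
    quotient_sup c f g = extremal_value c].
Proof.
move=> c0 F1; have [X X0 XE] := energy_cst1_pos.
have fS := normalized_sphere (@expands_cst R 1) X0 XE.
set f := (fun z => _) in fS.
exists f, f; split=> //; apply/eqP; rewrite eq_le; apply/andP; split.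
  by apply: le_trans F1; apply: quotient_sup_le => // z _; rewrite mul1r.
by apply: ereal_inf_lbound; exists f, f.
Qed.

(** A minimizing sequence can be kept below a factor [s < 1]; this is what keeps a
    definite part of the mass of [fn] inside the disc of radius [c], and so rules
    out a zero limit. *)
Lemma extremal_pair_of_lt1 (c : R) : 0 < c -> c < 1 -> (extremal_value c < 1)%E ->
  exists f g : R[i] -> R[i], [/\ bergman_sphere f, bergman_sphere g &
    quotient_sup c f g = extremal_value c].
Proof.
move=> c0 c1 F1; have F0 := extremal_value_ge0 c0 c1.
have [phi FE] : exists phi : R, extremal_value c = phi%:E.
  by move: F0 F1; case: (extremal_value c) => [phi||] // _ _; exists phi.
rewrite FE lte_fin in F1; rewrite FE lee_fin in F0; rewrite FE.
pose t (n : nat) : R := phi + (1 - phi) / 2 * n.+1%:R^-1.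
have ephi : 0 < (1 - phi) / 2 by lra.
have tphi n : phi < t n by rewrite ltrDl mulr_gt0 ?invr_gt0.
have /choice[fn /choice[gn P]] : forall n, exists f g, [/\ bergman_sphere f,
    bergman_sphere g & forall z : R[i], c <= modulus z < 1 ->
      modulus (f z) <= t n * modulus (g z)].
  by move=> n; apply: extremal_value_approx; rewrite FE lte_fin.
have fan n : analytic_on unit_disc (fn n) by have [/bergman_sphereP[]] := P n.
have gan n : analytic_on unit_disc (gn n) by have [_ /bergman_sphereP[]] := P n.
have fnE n : energy (disc 1) (fn n) = (pi : R)%:E by have [/bergman_sphereP[]] := P n.
have gnE n : energy (disc 1) (gn n) = (pi : R)%:E by have [_ /bergman_sphereP[]] := P n.
have fgn n : forall z : R[i], c <= modulus z < 1 ->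
    modulus (fn n z) <= t n * modulus (gn n z) by have [] := P n.
have /choice[an anf] : forall n, exists a, expands_at (fn n) 0 a 1.
  by move=> n; exact: analytic_expansion.
have /choice[bn bng] : forall n, exists b, expands_at (gn n) 0 b 1.
  by move=> n; exact: analytic_expansion.
have [sg [f [g [a [b [sgm af bg ft gt]]]]]] :=
  bergman_sphere_compact anf bng fnE gnE.
pose s := (1 + phi) / 2.
have tle m n : (m <= n)%N -> t n <= t m.
  move=> mn; rewrite /t lerD2l ler_wpM2l ?(ltW ephi)// lef_pV2 ?posrE//.
  by rewrite ler_nat ltnS.
have ts n : t n <= s.
  by apply: le_trans (tle 0%N n _) _ => //; rewrite /t /s invr1; lra.
have fgs n z : c <= modulus z < 1 -> modulus (fn n z) <= s * modulus (gn n z).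
  by move=> zc; apply: le_trans (fgn n z zc) _; rewrite ler_wpM2r ?modulus_ge0.
have fg z : c <= modulus z < 1 -> modulus (f z) <= phi * modulus (g z).
  move=> zc; have /andP[_ z1] := zc.
  have tcv : t m @[m --> \oo] --> phi.
    rewrite -[X in _ --> X]addr0; apply: cvgD; first exact: cvg_cst.
    rewrite -(mulr0 ((1 - phi) / 2)); apply: cvgMr; exact: inv_succ_cvg0.
  have h : t m * modulus (gn (sg m) z) @[m --> \oo] --> phi * modulus (g z).
    by apply: cvgM => //; exact: tends_modulus (gt z z1).
  apply: (ler_cvg_to (tends_modulus (ft z z1)) h); apply: nearW => m /=.
  apply: le_trans (fgn _ z zc) _; rewrite ler_wpM2r ?modulus_ge0//.
  exact: tle (sgm m).
have [M fM] : exists M, forall n z, modulus z < c ->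
    modulus (fn n z) <= M /\ modulus (gn n z) <= M.
  have [r /andP[cr r1]] : exists r, c < r < 1.
    by exists ((c + 1) / 2); apply/andP; split; lra.
  have r0 : 0 < r by lra.
  have [K KP] := bergman_sphere_bounded r0 r1.
  exists (K / (1 - c / r)) => n z zc.
  have zr : modulus z < r by lra.
  have K0 : 0 <= K := Cauchy_bound_ge0 (KP _ _ (anf 0%N) (fnE 0%N)).
  have mono : K / (1 - modulus z / r) <= K / (1 - c / r).
    have c1r : c / r < 1 by rewrite ltr_pdivrMr// mul1r.
    have zcr : modulus z / r <= c / r by rewrite ler_pM2r ?invr_gt0// ltW.
    by rewrite ler_wpM2l// lef_pV2 ?posrE ?subr_gt0//; lra.
  have z1 : modulus z < 1 by lra.
  split; apply: le_trans mono.
    have := anf n _ z1; rewrite add0r.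
    exact: (Cauchy_bound_modulus r0 zr (KP _ _ (anf n) (fnE n))).
  have := bng n _ z1; rewrite add0r.
  exact: (Cauchy_bound_modulus r0 zr (KP _ _ (bng n) (gnE n))).
have s0 : 0 <= s by rewrite /s; lra.
have s1 : s <= 1 by rewrite /s; lra.
have [gf fpos] := @energy_limit R c s M pi (fun m => fn (sg m)) (fun m => gn (sg m))
  (fun m => an (sg m)) (fun m => bn (sg m)) f g a b c1 s0 s1
  (fun m => anf (sg m)) (fun m => bng (sg m)) af bg ft gt
  (fun m z zc => (fM (sg m) z zc).1) (fun m z zc => (fM (sg m) z zc).2)
  (fun m => fnE (sg m)) (fun m => gnE (sg m)) (fun m => fgs (sg m)).
have fpi := fatou_energy (fun m => anf (sg m)) ft (fun m => fnE (sg m)).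
have [X XE] : exists X : R, energy (disc 1) f = X%:E.
  move: fpi (energy_ge0 (disc 1) f); case: (energy _ _) => [X||] // _ _.
  by exists X.
have [Y YE] : exists Y : R, energy (disc 1) g = Y%:E.
  move: gf (energy_ge0 (disc 1) g); rewrite XE; case: (energy _ _) => [Y||] // _ _.
  by exists Y.
have YX : Y <= X by rewrite -lee_fin -XE -YE.
have X0 : 0 < X.
  have : (((1 - s ^+ 2) * pi)%:E <= energy (disc 1) f)%E.
    apply: le_trans fpos _; rewrite (energy_split (ltW c1) af).
    by rewrite leeDl ?energy_ge0.
  rewrite XE lee_fin; apply: lt_le_trans; rewrite mulr_gt0 ?pi_gt0//.
  by rewrite /s; nra.
have Y0 : 0 < Y.
  rewrite lt_neqAle -lee_fin -YE energy_ge0 andbT; apply/eqP => Y0.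
  have b0 := energy_eq0 bg _; rewrite YE -Y0 in b0; have {}b0 := b0 (lexx _).
  have a0 : forall k, a k = 0.
    apply: (expansion_vanishing c0 c1 af) => z zc; have /andP[_ z1] := zc.
    apply/eqP; rewrite -modulus_eq0 eq_le modulus_ge0 andbT.
    by have := fg z zc; rewrite (expansion_eq0 bg b0 z1) modulus0 mulr0.
  move: XE; rewrite /energy integral0_eq => [[XE]|p p1].
    by move: X0; rewrite -XE ltxx.
  by rewrite (expansion_eq0 af a0 p1) modulus0 expr0n.
have fS := normalized_sphere af X0 XE; have gS := normalized_sphere bg Y0 YE.
exists (fun z => (Num.sqrt (pi / X))%:C * f z), (fun z => (Num.sqrt (pi / Y))%:C * g z).
split=> //; apply/eqP; rewrite eq_le; apply/andP; split; last first.
  by rewrite -FE; apply: ereal_inf_lbound; eexists _, _; split; [exact: fS|exact: gS|].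
apply: quotient_sup_le => // z zc.
rewrite !modulusM !modulus_real !ger0_norm ?sqrtr_ge0//.
have XY : Num.sqrt (pi / X) <= Num.sqrt (pi / Y) :> R.
  by apply: ler_wsqrtr; rewrite ler_pM2l ?pi_gt0// lef_pV2 ?posrE.
rewrite [leRHS]mulrCA; apply: ler_pM (fg z zc) => //; exact: modulus_ge0.
Qed.

End Extremal.

Theorem proposition4p1 (R : realType) (c : R) (c_gt0 : 0 < c) (c_lt1 : c < 1) :
  exists f g : R[i] -> R[i],
    [/\ bergman_sphere f, bergman_sphere g &
        quotient_sup c f g = extremal_value c].
Proof.
have [F1|F1] := leP 1%E (extremal_value c); first exact: extremal_pair_of_ge1.
exact: extremal_pair_of_lt1.
Qed.
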